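(* (i) Almost all $3$-uniform hypergraphs are weakly $2$-weighted but not weakly $1$-weighted. (ii) For every $r\ge 4$, almost all $r$-uniform hypergraphs are weakly $1$-weighted.
   Context: An $r$-uniform hypergraph $H=(V,E)$ has every edge of size $r$. Given $\omega:E\to\{1,\dots,w\}$, the induced vertex-coloring is $c(v)=\sum_{e\ni v}\omega(e)$. The coloring is weak if no edge is monochromatic. $H$ is weakly $w$-weighted if some $\omega:E\to\{1,\dots,w\}$ induces a weak coloring. ''Almost all $r$-uniform hypergraphs on $n$ vertices have property $\mathcal P$'' means that the number of $r$-uniform hypergraphs on vertex set $[n]$ without $\mathcal P$ is $o\big(2^{\binom{n}{r}}\big)$ as $n\to\infty$. *)

(* Defs.v *)
From mathcomp Require Import all_boot.
Set Implicit Arguments. Unset Strict Implicit. Unset Printing Implicit Defensive.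

Definition uniform (n r : nat) (E : {set {set 'I_n}}) : bool :=
  [forall e in E, #|e| == r].

(* Induced vertex colouring c(v) = sum_{e ∋ v} ω(e), where a weighting
   ω : E -> {1,...,w} is encoded as om : {ffun {set 'I_n} -> 'I_w},
   with ω(e) = (om e).+1 (so ω(e) ranges exactly over 1..w). *)
Definition induced_color (n w : nat) (E : {set {set 'I_n}})
  (om : {ffun {set 'I_n} -> 'I_w}) (v : 'I_n) : nat :=
  \sum_(e in E | v \in e) (om e).+1.

Definition monochromatic (n w : nat) (E : {set {set 'I_n}})
  (om : {ffun {set 'I_n} -> 'I_w}) (e : {set 'I_n}) : bool :=
  [forall u in e, forall v in e, induced_color E om u == induced_color E om v].

Definition weakly_weighted (n : nat) (E : {set {set 'I_n}}) (w : nat) : bool :=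
  [exists om : {ffun {set 'I_n} -> 'I_w},
     [forall e in E, ~~ monochromatic E om e]].

(* "Almost all r-uniform hypergraphs have P": the number of r-uniform
   hypergraphs on [n] without P is o(2^C(n,r)), i.e. for every k > 0,
   eventually k * (that number) <= 2^C(n,r). *)
Definition almost_all (r : nat) (P : forall n, {set {set 'I_n}} -> bool) : Prop :=
  forall k : nat, 0 < k -> exists N : nat, forall n : nat, N <= n ->
    k * #|[set E : {set {set 'I_n}} | uniform r E && ~~ P n E]| <= 2 ^ 'C(n, r).

(* Main.v *)
Require Import Defs.
From mathcomp Require Import all_boot all_order all_algebra ring lra zify perm.
Set Implicit Arguments. Unset Strict Implicit. Unset Printing Implicit Defensive.
Import Order.TTheory GRing.Theory Num.Theory.
Local Open Scope ring_scope.

(** Everything is a computation with a uniformly random E, a subset of the r-sets of [n].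
    Conditioning on all edges but those meeting a given set of vertices in one point only, each
    colour is a constant plus an independent binomial, so a prescribed value has probability
    O(n^(-(r-1)/2)) and k given vertices are equally coloured with probability
    O(n^(-(k-1)(r-1)/2)). For r >= 4, four vertices of each edge and a union bound suffice.

    For r = 3 and two weights, give weight 2 to the edges whose index sum exceeds a threshold.
    The mean colour then increases with the vertex, at rate of order n per step; an exponential
    moment shows that vertices at distance of order log n have different colours, and few edges
    have all their vertices closer than that.

    For r = 3 and one weight, apply the second moment method to the number of monochromatic
    edges. A triple is an edge with equal degrees with probability F('C(n-2,2)) / 2, where
    F m = sum_x ('C(m,x) / 2^m)^3; two disjoint triples with probability at most
    F('C(n-6,2))^2 / 4, by AM-GM; and F(m-1) <= F(m) (1 + 12/m) makes these comparable. *)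

(** A union bound over all edges, using k vertices of each, costs n^(r - (k-1)(r-1)/2). With k = 4
    the exponent is (3 - r)/2, which is negative exactly from r = 4 on. For r = 3 only three
    vertices are available and the exponent is 1: the expected number of monochromatic edges is at
    least of order n. This is why one weight fails, and why two weights call for a weighting that
    separates distant vertices systematically; the edges left over number O(n log^2 n) against a
    probability O(n^-2).

    In the second moment method the disjoint pairs of edges must contribute the squared mean up to a
    factor 1 + o(1), so bounding F up to constants is useless there. Its asymptotics are avoided:
    the two arguments of F, both of order n^2, differ by about 4 n, and a relative change O(1/m) per
    unit step accumulates to O(1/n) only. Elsewhere the crude bound F m >= 1/(4 m) is enough.

    All estimates stay in the rationals: bounds of order m^(-1/2) are stated through squares, and
    exponentials are replaced by Bernoulli's inequality. *)

(** * Point probabilities of the symmetric binomial distribution *)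

Lemma leq_bin_half m x : ('C(m, x) <= 'C(m, m./2))%N.
Proof.
have bin_dec y : (m./2 <= y)%N -> ('C(m, y.+1) <= 'C(m, y))%N.
  move=> le_y; rewrite -(leq_pmul2l (ltn0Sn y)) mul_bin_left leq_mul2r.
  by apply/orP; right; lia.
have bin_ge y : ('C(m, m./2 + y) <= 'C(m, m./2))%N.
  elim: y => [|y IH]; first by rewrite addn0.
  by rewrite addnS (leq_trans (bin_dec _ _) IH) // leq_addr.
have [le_x|lt_x] := leqP m./2 x; first by rewrite -(subnKC le_x) bin_ge.
have le_xm : (x <= m)%N by lia.
have le_mx : (m./2 <= m - x)%N by lia.
by rewrite -(bin_sub le_xm) -(subnKC le_mx) bin_ge.
Qed.

(** Plays two roles: the largest point probability of 2k fair trials ([bpm_half]), and the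
    probability that two independent binomials with k trials agree ([sum_bpm_sqr]). *)
Definition central k : rat := 'C(k.*2, k)%:R / 4 ^+ k.

Lemma bin_double k : 'C(k.+1.*2, k.+1) = ('C(k.*2.+1, k)).*2.
Proof.
apply/eqP; rewrite -(eqn_pmul2l (ltn0Sn k)) -mul_bin_diag doubleS /=.
by rewrite -!muln2; apply/eqP; lia.
Qed.

Lemma centralS k : central k.+1 * (2 * k%:R + 2) = central k * (2 * k%:R + 1).
Proof.
have E : (k.+1 * 'C(k.+1.*2, k.+1))%N = (2 * (k.*2.+1 * 'C(k.*2, k)))%N.
  rewrite bin_double -[k.*2.+1 in RHS]/(k.*2.+1) (mul_bin_diag k.*2.+1 k).
  have -> : 'C(k.*2.+1, k.+1) = 'C(k.*2.+1, k).
    by rewrite -bin_sub; [congr binomial; lia | lia].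
  by rewrite -muln2; lia.
have {}E : (k%:R + 1) * 'C(k.+1.*2, k.+1)%:R =
   2 * ((2 * k%:R + 1) * 'C(k.*2, k)%:R) :> rat.
  by move/(congr1 (fun n => n%:R : rat)): E; rewrite /= !natrM -[k.+1%:R]natr1 -[k.*2.+1%:R]natr1
    -(mul2n k) natrM.
rewrite /central exprS; move: E; set a := 'C(k.+1.*2, _)%:R; set b := 'C(_, _)%:R => E.
have -> : a / (4 * 4 ^+ k) * (2 * k%:R + 2) = ((k%:R + 1) * a) / (2 * 4 ^+ k) :> rat.
  by field; exact: expf_neq0.
by rewrite E; field; exact: expf_neq0.
Qed.

Lemma central_ge0 k : 0 <= central k.
Proof. by rewrite divr_ge0 ?exprn_ge0. Qed.

(** The left side decreases: by [centralS], a step multiplies it by (2k+1)(2k+3)/(2k+2)^2 < 1. In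
    [central_ge] the corresponding factor is (2k+1)^2/(4k(k+1)) > 1. *)
Lemma central_le k : central k ^+ 2 * (2 * k%:R + 1) <= 1.
Proof.
elim: k => [|k IH]; first by rewrite /central bin0 expr0 divr1; lra.
have k0 : 0 <= k%:R :> rat := ler0n _ _.
have k1 : 0 < 2 * k%:R + 2 :> rat by lra.
rewrite -(ler_pM2r (exprn_gt0 2 k1)).
have -> : central k.+1 ^+ 2 * (2 * k.+1%:R + 1) * (2 * k%:R + 2) ^+ 2 =
  (central k.+1 * (2 * k%:R + 2)) ^+ 2 * (2 * k%:R + 3).
  by rewrite -natr1; ring.
rewrite centralS.
have -> : (central k * (2 * k%:R + 1)) ^+ 2 * (2 * k%:R + 3) =
   (central k ^+ 2 * (2 * k%:R + 1)) * ((2 * k%:R + 1) * (2 * k%:R + 3)) by ring.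
by nra.
Qed.

Lemma central_ge k : (0 < k)%N -> 1 <= central k ^+ 2 * (4 * k%:R).
Proof.
case: k => [//|k] _; elim: k => [|k IH]; first by rewrite /central; have -> : 'C(1.*2, 1) = 2%N by
  []; rewrite expr1; lra.
have k0 : 0 <= k.+1%:R :> rat := ler0n _ _.
have k1 : 0 < 2 * k.+1%:R + 2 :> rat by lra.
rewrite -(ler_pM2r (exprn_gt0 2 k1)).
have -> : central k.+2 ^+ 2 * (4 * k.+2%:R) * (2 * k.+1%:R + 2) ^+ 2 =
  (central k.+1 * (2 * k.+1%:R + 1)) ^+ 2 * (4 * k.+2%:R).
  by rewrite -centralS; ring.
have k2 : 0 < k.+1%:R :> rat by rewrite ltr0n.
rewrite -[k.+2%:R]natr1; set c := central _ in IH *; set x := k.+1%:R in IH k0 k2 *.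
have : (2 * x + 2) ^+ 2 * x <= (2 * x + 1) ^+ 2 * (x + 1) by nra.
move=> le_x; rewrite -(ler_pM2r k2).
have := ler_wpM2r (_ : 0 <= (2 * x + 1) ^+ 2 * (x + 1)) IH; rewrite mul1r => le1.
have {}le1 := le_trans le_x (le1 _).
rewrite mul1r (le_trans (le1 _)) //; first by nra.
by rewrite le_eqVlt; apply/orP; left; apply/eqP; ring.
Qed.

Definition bpm m x : rat := 'C(m, x)%:R / 2 ^+ m.

Lemma bpm_ge0 m x : 0 <= bpm m x.
Proof. by rewrite divr_ge0 ?exprn_ge0. Qed.

Lemma sum_bpm m : \sum_(x < m.+1) bpm m x = 1.
Proof.
have := @exprDn rat 1 1 m.
under eq_bigr do rewrite !expr1n mulr1.
rewrite -mulr_suml => <-; rewrite divff //; exact: expf_neq0.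
Qed.

Lemma bpm_sym m x : (x <= m)%N -> bpm m (m - x) = bpm m x.
Proof. by move=> le_xm; rewrite /bpm bin_sub. Qed.

(** The middle mass of 2k+1 trials equals that of 2k+2 trials, so an odd m is rounded up to an even
    number. *)
Lemma bpm_half m : exists2 k, (m <= k.*2)%N & bpm m m./2 = central k.
Proof.
have p2 k : 2 ^+ k.*2 = 4 ^+ k :> rat by rewrite -mul2n exprM; congr (_ ^+ _); ring.
rewrite -{1 2}(odd_double_half m); case: (odd m); last first.
  by exists m./2; rewrite // add0n /bpm /central p2.
exists m./2.+1; first by lia.
rewrite /bpm /central bin_double add1n exprS -[X in _ = X%:R / _]muln2 natrM exprS p2.
by field; exact: expf_neq0.
Qed.

Lemma bpm_sqr_le m x : bpm m x ^+ 2 * m.+1%:R <= 1.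
Proof.
have [k le_mk Ek] := bpm_half m.
apply: le_trans (central_le k); apply: ler_pM; rewrite ?sqr_ge0 //.
  rewrite ler_sqr ?nnegrE ?bpm_ge0 ?central_ge0 // -Ek.
  by rewrite ler_pM2r ?invr_gt0 ?exprn_gt0 // ler_nat leq_bin_half.
by rewrite -natrM natr1 ler_nat; lia.
Qed.

(** * The coincidence probability of three binomials *)

(** The probability that three independent binomials with m fair trials are equal; see
    [sum_bpm_diag]. *)
Definition cube_sum m : rat := \sum_(x < m.+1) bpm m x ^+ 3.

Lemma sum_bpm_sqr m : \sum_(x < m.+1) bpm m x ^+ 2 = central m.
Proof.
rewrite /central -addnn -binomial.Vandermonde natr_sum mulr_suml.
apply: eq_bigr => x _; rewrite (bin_sub (leq_ord x)) natrM.
have -> : 4 = 2 ^+ 2 :> rat by ring.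
by rewrite /bpm -exprM mulnC exprM; field; exact: expf_neq0.
Qed.

(* Cauchy-Schwarz: (sum b^2)^2 <= (sum b) (sum b^3), with sum b^2 = C(2N, N) / 4^N. *)
Lemma cube_sum_ge m : (0 < m)%N -> 1 <= cube_sum m * (4 * m%:R).
Proof.
move=> m0; apply: le_trans (central_ge m0) _; rewrite ler_wpM2r ?mulr_ge0 //.
set c := central m.
have : 0 <= \sum_(x < m.+1) bpm m x * (bpm m x - c) ^+ 2.
  by apply: sumr_ge0 => x _; rewrite mulr_ge0 ?bpm_ge0 ?sqr_ge0.
rewrite (eq_bigr (fun x : 'I_m.+1 => bpm m x ^+ 3 - (2 * c) * bpm m x ^+ 2 + c ^+ 2 * bpm m x));
  last by move=> x _; ring.
rewrite big_split sumrB -!mulr_sumr /= sum_bpm sum_bpm_sqr -/c -/(cube_sum m).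
nra.
Qed.

Lemma cube_sum_ge0 m : 0 <= cube_sum m.
Proof. by apply: sumr_ge0 => x _; rewrite exprn_ge0 ?bpm_ge0. Qed.

(** The deviation from the mean m/2, scaled to [-1, 1] with reversed sign. It is odd under x -> m -
    x, and 1 + [skew] is the ratio of consecutive masses in [bpm_pred]. *)
Definition skew m x : rat := 1 - 2 * x%:R / m%:R.

Lemma bpm_pred m x : (x <= m)%N -> bpm m x = bpm m.+1 x * (1 + skew m.+1 x).
Proof.
move=> le_xm; have m0 : m.+1%:R != 0 :> rat by rewrite pnatr_eq0.
have E : m.+1%:R * 'C(m, x)%:R = (m.+1%:R - x%:R) * 'C(m.+1, x)%:R :> rat.
  by rewrite -natrM (mul_bin_down m.+1) natrM natrB // leqW.
have -> : bpm m x = (m.+1%:R * 'C(m, x)%:R) / (m.+1%:R * 2 ^+ m).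
  by rewrite /bpm; field; rewrite ?nat1r ?natr1 ?pnatr_eq0 ?expf_neq0.
by rewrite E /bpm /skew exprS; field; rewrite ?nat1r ?natr1 ?pnatr_eq0 ?expf_neq0.
Qed.

Lemma sum_skew_odd m (g : rat -> rat) : (forall u, g (- u) = - g u) ->
  \sum_(x < m.+2) bpm m.+1 x ^+ 3 * g (skew m.+1 x) = 0.
Proof.
move=> oddg; set S := LHS.
suff : S = - S by lra.
rewrite {1}/S (reindex_inj rev_ord_inj) /= /S -sumrN; apply: eq_bigr => x _.
have le_x := leq_ord x.
rewrite subSS bpm_sym //.
have -> : skew m.+1 (m.+1 - x) = - skew m.+1 x.
  rewrite /skew natrB //; have m0 : m.+1%:R != 0 :> rat by rewrite pnatr_eq0.
  by field; rewrite ?nat1r ?natr1 ?pnatr_eq0.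
by rewrite oddg mulrN.
Qed.

(** The variance N/4 of a binomial with N trials, scaled by 4/N^2; it is assembled from the first
    two factorial moments. *)
Lemma sum_bpm_skew_sqr m : \sum_(x < m.+2) bpm m.+1 x * skew m.+1 x ^+ 2 = m.+1%:R ^-1.
Proof.
have m0 : m.+1%:R != 0 :> rat by rewrite pnatr_eq0.
have mean_x k : \sum_(x < k.+2) bpm k.+1 x * x%:R = k.+1%:R / 2.
  rewrite big_ord_recl mulr0 add0r.
  transitivity (\sum_(x < k.+1) bpm k x * (k.+1%:R / 2)).
    apply: eq_bigr => x _; rewrite lift0.
    have := mul_bin_diag k.+1 x; move/(congr1 (fun n => n%:R : rat)); rewrite !natrM /= => E.
    have -> : bpm k.+1 x.+1 * x.+1%:R = (x.+1%:R * 'C(k.+1, x.+1)%:R) / 2 ^+ k.+1.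
      by rewrite /bpm; field; exact: expf_neq0.
    by rewrite -E /bpm exprS; field; exact: expf_neq0.
  by rewrite -mulr_suml sum_bpm mul1r.
have mean_xx : \sum_(x < m.+2) bpm m.+1 x * (x%:R * (x%:R - 1)) = m.+1%:R * m%:R / 4.
  rewrite big_ord_recl mul0r mulr0 add0r.
  transitivity (\sum_(x < m.+1) bpm m x * x%:R * (m.+1%:R / 2)).
    apply: eq_bigr => x _; rewrite lift0.
    have := mul_bin_diag m.+1 x; move/(congr1 (fun n => n%:R : rat)); rewrite !natrM /= => E.
    have -> : bpm m.+1 x.+1 * (x.+1%:R * (x.+1%:R - 1)) =
       (x.+1%:R * 'C(m.+1, x.+1)%:R) * x%:R / 2 ^+ m.+1.
      by rewrite /bpm -[x.+1%:R]natr1; field; exact: expf_neq0.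
    by rewrite -E /bpm exprS; field; exact: expf_neq0.
  rewrite -mulr_suml; case: m {m0} => [|m]; first by rewrite big_ord_recl big_ord0 /= !(mulr0,
    mul0r, addr0).
  by rewrite mean_x; field.
rewrite (eq_bigr (fun x : 'I_m.+2 => bpm m.+1 x + (4 / m.+1%:R ^+ 2) * (bpm m.+1 x * (x%:R * (x%:R - 1)))
   + (4 / m.+1%:R ^+ 2 - 4 / m.+1%:R) * (bpm m.+1 x * x%:R))); last first.
  by move=> x _; rewrite /skew; field; rewrite ?nat1r ?natr1 ?pnatr_eq0.
rewrite !big_split -!mulr_sumr /= sum_bpm mean_x mean_xx -[m.+1%:R]natr1.
by field; rewrite ?nat1r ?natr1 ?pnatr_eq0.
Qed.

(** In the expansion of (1 + s)^3, s being the skew, the odd powers cancel by symmetry. What remains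
    is 3 times the sum of b^3 s^2, at most the largest b^2 times the variance of s, hence at most
    1/V^2 with V = m + 1; and 1/V <= 4 F by [cube_sum_ge], so that 12 = 3 * 4. The cancellation is
    essential: an error of order m^(-1/2) per step would not survive the roughly 4 n steps taken
    later with m of order n^2. *)
Lemma cube_sum_pred m : cube_sum m <= cube_sum m.+1 * (1 + 12 / m.+1%:R).
Proof.
have m0 : 0 < m.+1%:R :> rat by rewrite ltr0n.
have -> : cube_sum m = \sum_(x < m.+2) (bpm m.+1 x * (1 + skew m.+1 x)) ^+ 3.
  rewrite big_ord_recr /=.
  have -> : 1 + skew m.+1 m.+1 = 0 by rewrite /skew; field; rewrite ?nat1r ?natr1 ?pnatr_eq0.
  rewrite mulr0 expr0n addr0; apply: eq_bigr => x _.
  by rewrite (@bpm_pred m x) ?leq_ord.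
rewrite (eq_bigr (fun x : 'I_m.+2 => bpm m.+1 x ^+ 3 + 3 * (bpm m.+1 x ^+ 3 * skew m.+1 x ^+ 2)
   + bpm m.+1 x ^+ 3 * (3 * skew m.+1 x + skew m.+1 x ^+ 3))); last by move=> x _; ring.
rewrite !big_split -!mulr_sumr /=.
rewrite (@sum_skew_odd m (fun u => 3 * u + u ^+ 3)); last by move=> u; ring.
have : \sum_(x < m.+2) bpm m.+1 x ^+ 3 * skew m.+1 x ^+ 2 <= m.+1%:R ^-1 ^+ 2.
  rewrite [leRHS]expr2 -[X in _ <= _ * X]sum_bpm_skew_sqr mulr_sumr; apply: ler_sum => x _.
  have -> : bpm m.+1 x ^+ 3 * skew m.+1 x ^+ 2 =
            bpm m.+1 x ^+ 2 * (bpm m.+1 x * skew m.+1 x ^+ 2) by ring.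
  apply: ler_wpM2r; first by rewrite mulr_ge0 ?bpm_ge0 ?sqr_ge0.
  rewrite -(ler_pM2r m0) mulVf ?lt0r_neq0 //.
  apply: le_trans (bpm_sqr_le m.+1 x); rewrite ler_wpM2l ?sqr_ge0 // ler_nat //.
have := cube_sum_ge (ltn0Sn m); rewrite -/(cube_sum m.+1).
set F := cube_sum _; set V := m.+1%:R in m0 *; set S := \sum_(i < _) _ => geF leS.
have iV : 0 < V^-1 by rewrite invr_gt0.
have {}geF : V^-1 <= 4 * F.
  by rewrite -(ler_pM2r m0) mulVf ?lt0r_neq0 //; lra.
have : V^-1 ^+ 2 <= 4 * F * V^-1 by rewrite expr2 ler_wpM2r // ltW.
move=> le2; rewrite addr0.
have -> : F * (1 + 12 / V) = F + 3 * (4 * F * V^-1) by ring.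
by rewrite lerD2l ler_pM2l // (le_trans leS).
Qed.

(** * Averages over a uniformly random subset of K *)

Section RandomSubset.
Variable T : finType.
Implicit Types (K P E D : {set T}) (f g : {set T} -> rat).

Definition mean K f : rat := (\sum_(E in powerset K) f E) / 2 ^+ #|K|.

Lemma mean_eq K f g : (forall E, E \subset K -> f E = g E) -> mean K f = mean K g.
Proof.
move=> fg; congr (_ / _); apply: eq_bigr => E; rewrite powersetE; exact: fg.
Qed.

Lemma mean_le K f g : (forall E, E \subset K -> f E <= g E) -> mean K f <= mean K g.
Proof.
move=> fg; rewrite ler_pM2r ?invr_gt0 ?exprn_gt0 //.
by apply: ler_sum => E; rewrite powersetE; exact: fg.
Qed.

Lemma mean_cst K c : mean K (fun=> c) = c.
Proof.
rewrite /mean sumr_const card_powerset -[c *+ _]mulr_natr natrX mulfK //.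
exact: expf_neq0.
Qed.

Lemma meanZ K c f : mean K (fun E => c * f E) = c * mean K f.
Proof. by rewrite /mean -mulr_sumr mulrA. Qed.

Lemma mean_sum (I : finType) (A : pred I) K (F : I -> {set T} -> rat) :
  mean K (fun E => \sum_(i | A i) F i E) = \sum_(i | A i) mean K (F i).
Proof. by rewrite /mean exchange_big mulr_suml. Qed.

Lemma meanD K f g : mean K (fun E => f E + g E) = mean K f + mean K g.
Proof. by rewrite /mean big_split mulrDl. Qed.

(** Fubini: the traces of a random subset on P and on its complement are independent. *)
Lemma mean_split K P f : P \subset K ->
  mean K f = mean (K :\: P) (fun A => mean P (fun B => f (A :|: B))).
Proof.
move=> sPK; rewrite /mean.
rewrite -mulr_suml -mulrA -invfM -exprD.
have -> : (#|P| + #|K :\: P|)%N = #|K| by rewrite -(cardsID P K) (setIidPr sPK).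
congr (_ / _); rewrite pair_big /=.
rewrite (reindex_onto (fun p : {set T} * {set T} => p.1 :|: p.2)
  (fun E => (E :\: P, E :&: P))) /=; last first.
  by move=> E _; rewrite setUC setID.
apply: eq_bigl => -[A B] /=; rewrite !powersetE.
apply/andP/andP => [[sK /eqP[EA EB]]|[sA sB]].
  split; last by rewrite -EB subsetIr.
  by rewrite -EA setSD.
have dA : [disjoint A & P] by move: sA; rewrite subsetD => /andP[].
split.
  rewrite subUset (subset_trans sB sPK) andbT; exact: subset_trans sA (subsetDl _ _).
have AP : A :&: P = set0 by apply/eqP; rewrite setI_eq0.
apply/eqP; congr (_, _).
  rewrite setDUl; have -> : B :\: P = set0 by apply/eqP; rewrite setD_eq0.
  by rewrite setU0; apply/setDidPl.
by rewrite setIUl AP set0U; apply/setIidPl.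
Qed.

Lemma mean_card P (g : nat -> rat) :
  mean P (fun B => g #|B|) = \sum_(x < #|P|.+1) bpm #|P| x * g x.
Proof.
rewrite /mean (partition_big (fun B : {set T} => inord #|B| : 'I_#|P|.+1) predT) //= mulr_suml.
apply: eq_bigr => x _; rewrite (eq_bigr (fun=> g x)); last first.
  by move=> B /andP[]; rewrite powersetE => /subset_leq_card leB /eqP <-; rewrite inordK.
rewrite sumr_const /bpm -(cards_draws P x) -[g x *+ _]mulr_natl [RHS]mulrAC; congr (_%:R * _ / _).
apply: eq_card => B; rewrite unfold_in powersetE inE; case: (boolP (B \subset P)) => [sB|//] /=.
by rewrite -val_eqE /= inordK // ltnS subset_leq_card.
Qed.

(** Given E outside P, the size of E inside P is binomial. The right side is still an average over
    subsets of K, not of K minus P, so that conditioning can be repeated with another P. *)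
Lemma mean_cond K P (h : {set T} -> nat -> rat) : P \subset K ->
  mean K (fun E => h (E :\: P) #|E :&: P|) =
  mean K (fun E => \sum_(x < #|P|.+1) bpm #|P| x * h (E :\: P) x).
Proof.
move=> sPK; rewrite !(mean_split _ sPK); apply: mean_eq => A; rewrite subsetD => /andP[_ dA].
have AP : A :&: P = set0 by apply/eqP; rewrite setI_eq0.
have DP (B : {set T}) : B \subset P -> (A :|: B) :\: P = A.
  move=> sB; rewrite setDUl; have -> : B :\: P = set0 by apply/eqP; rewrite setD_eq0.
  by rewrite setU0; apply/setDidPl.
rewrite (@mean_eq P _ (fun B => h A #|B|)); last first.
  by move=> B sB; rewrite DP // setIUl AP set0U (setIidPl sB).
rewrite mean_card -[LHS](mean_cst P); apply: mean_eq => B sB.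
by rewrite DP.
Qed.

Lemma mean_cond3 K (R1 R2 R3 : {set T}) (h : {set T} -> nat -> nat -> nat -> rat) :
  R1 \subset K -> R2 \subset K -> R3 \subset K ->
  [disjoint R1 & R2] -> [disjoint R1 & R3] -> [disjoint R2 & R3] ->
  let D E := E :\: (R1 :|: R2 :|: R3) in
  mean K (fun E => h (D E) #|E :&: R1| #|E :&: R2| #|E :&: R3|) =
  mean K (fun E => \sum_(x < #|R1|.+1) \sum_(y < #|R2|.+1) \sum_(z < #|R3|.+1)
     bpm #|R1| x * bpm #|R2| y * bpm #|R3| z * h (D E) x y z).
Proof.
move=> s1 s2 s3 d12 d13 d23 D.
have ID (A B E : {set T}) : [disjoint A & B] -> (E :\: A) :&: B = E :&: B.
  by move=> dAB; rewrite setIDAC; apply/setDidPl; rewrite disjoint_sym;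
     apply: disjointWr dAB; exact: subsetIr.
have DD (A E : {set T}) : A \subset R1 :|: R2 :|: R3 -> (E :\: A) :\: (R1 :|: R2 :|: R3) = D E.
  by move=> sA; rewrite setDDl (setUidPr sA).
have sR1 : R1 \subset R1 :|: R2 :|: R3 by rewrite -setUA subsetUl.
have sR2 : R2 \subset R1 :|: R2 :|: R3 by rewrite setUAC subsetUr.
have sR3 : R3 \subset R1 :|: R2 :|: R3 by rewrite subsetUr.
transitivity (mean K (fun E => \sum_(x < #|R1|.+1) bpm #|R1| x * h (D E) x #|E :&: R2| #|E :&: R3|)).
  have := mean_cond (fun A x => h (D A) x #|A :&: R2| #|A :&: R3|) s1.
  rewrite (mean_eq (g := fun E => h (D E) #|E :&: R1| #|E :&: R2| #|E :&: R3|)) => [->|E _].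
    by apply: mean_eq => E _; apply: eq_bigr => x _; rewrite !ID ///D DD.
  by rewrite !ID // /D DD.
transitivity (mean K (fun E => \sum_(x < #|R1|.+1) \sum_(y < #|R2|.+1)
    bpm #|R1| x * bpm #|R2| y * h (D E) x y #|E :&: R3|)).
  rewrite !mean_sum; apply: eq_bigr => x _.
  have := mean_cond (fun A y => bpm #|R1| x * h (D A) x y #|A :&: R3|) s2.
  rewrite (mean_eq (g := fun E => bpm #|R1| x * h (D E) x #|E :&: R2| #|E :&: R3|)) => [->|E _].
    by apply: mean_eq => E _; apply: eq_bigr => y _; rewrite !ID // /D DD // mulrCA mulrA.
  by rewrite !ID // /D DD.
rewrite !mean_sum; apply: eq_bigr => x _; rewrite !mean_sum; apply: eq_bigr => y _.
have := mean_cond (fun A z => bpm #|R1| x * bpm #|R2| y * h (D A) x y z) s3.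
rewrite (mean_eq (g := fun E => bpm #|R1| x * bpm #|R2| y * h (D E) x y #|E :&: R3|)) => [->|E _].
  by apply: mean_eq => E _; apply: eq_bigr => z _; rewrite /D DD //; ring.
by rewrite /D DD.
Qed.

(* Given the elements of E outside P, at most one value of |E :&: P| makes the two sides equal. *)
Lemma anticoncentration K P beta w (Q : pred {set T}) (a d : {set T} -> nat) :
  P \subset K -> (0 < w)%N -> (forall x, bpm #|P| x <= beta) ->
  mean K (fun E => (Q (E :\: P) && (a (E :\: P) + w * #|E :&: P| == d (E :\: P))%N)%:R) <=
  beta * mean K (fun E => (Q (E :\: P))%:R).
Proof.
move=> sPK w0 leb.
rewrite (mean_cond (fun A x => (Q A && (a A + w * x == d A)%N)%:R)) // -meanZ.
have beta0 : 0 <= beta by rewrite (le_trans (bpm_ge0 #|P| 0)).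
apply: mean_le => E _; set A := E :\: P; case: (Q A) => /=; last first.
  by rewrite big1 ?mulr0 // => x _; rewrite mulr0.
rewrite mulr1; case: (pickP (fun x : 'I_#|P|.+1 => a A + w * x == d A)%N) => [x Ex|none].
  rewrite (bigD1 x) //= big1 ?addr0 => [|y neq_yx].
    by rewrite Ex mulr1.
  case: eqP => [Ey|_]; last by rewrite mulr0.
  case/eqP: neq_yx; apply/val_inj => /=; apply/eqP.
  by rewrite -(eqn_pmul2l w0) -(eqn_add2l (a A)) Ey (eqP Ex).
by rewrite big1 // => x _; rewrite none mulr0.
Qed.

Lemma mean_symdiff K D f : D \subset K ->
  mean K f = mean K (fun E => f ((E :\: D) :|: (D :\: E))).
Proof.
move=> sDK; congr (_ / _).
have symK : involutive (fun E => (E :\: D) :|: (D :\: E)).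
  by move=> E; apply/setP => x; rewrite !inE; case: (x \in E); case: (x \in D).
rewrite (reindex_inj (inv_inj symK)); apply: eq_bigl => E; rewrite !powersetE.
apply/idP/idP => sE; last by rewrite subUset !(subset_trans (subsetDl _ _)).
apply/subsetP => x Ex; case: (boolP (x \in D)) => [/(subsetP sDK)//|Dx].
by apply: (subsetP sE); rewrite !inE Ex Dx.
Qed.

Lemma mean_mem K t f : t \in K -> (forall E, f (E :\ t) = f E) ->
  mean K (fun E => (t \in E)%:R * f E) = mean K f / 2.
Proof.
move=> Kt ft; have sK : [set t] \subset K by rewrite sub1set.
rewrite (mean_eq (g := fun E => (#|E :&: [set t]| == 1%N)%:R * f (E :\ t))); last first.
  move=> E _; rewrite ft; congr (_%:R * _).
  case: (boolP (t \in E)) => Et.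
    have -> : E :&: [set t] = [set t] by apply/setIidPr; rewrite sub1set.
    by rewrite cards1.
  have -> : E :&: [set t] = set0 by apply/eqP; rewrite setI_eq0 disjoint_sym disjoints1.
  by rewrite cards0.
rewrite (mean_cond (fun A x => (x == 1%N)%:R * f A)) // cards1 mulrC -meanZ.
apply: mean_eq => E _; rewrite !big_ord_recl big_ord0 /= ft /bpm !bin1 bin0.
by ring.
Qed.

Lemma mean_prod K (phi : T -> bool -> rat) :
  mean K (fun E => \prod_(t in K) phi t (t \in E)) =
  \prod_(t in K) ((phi t false + phi t true) / 2).
Proof.
rewrite big_split /= prodr_const exprVn; congr (_ / _).
(* With F zero outside K, expanding the product over all subsets of T leaves only those contained in
   K. *)
pose F t := if t \in K then phi t true else 0.
pose G t := if t \in K then phi t false else 1.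
transitivity (\prod_t (F t + G t)); last first.
  rewrite [RHS]big_mkcond; apply: eq_bigr => t _; rewrite /F /G.
  by case: ifP; rewrite ?add0r // addrC.
rewrite bigA_distr [LHS]big_mkcond; apply: eq_bigr => E _; rewrite powersetE.
case: ifPn => [sEK|/subsetPn[t Et Kt]].
  rewrite big_mkcond; apply: eq_bigr => t _; rewrite /F /G.
  case: (boolP (t \in E)) => [/(subsetP sEK)->//|_]; first by case: ifP.
by rewrite (bigD1 t) //= Et /F (negPf Kt) mul0r.
Qed.

End RandomSubset.

Lemma bpm_le_half m x : bpm m x <= bpm m m./2.
Proof. by rewrite ler_pM2r ?invr_gt0 ?exprn_gt0 // ler_nat leq_bin_half. Qed.

Lemma bpm_le m x beta : 0 <= beta -> 1 <= beta ^+ 2 * m.+1%:R -> bpm m x <= beta.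
Proof.
move=> b0 le1; rewrite -ler_sqr ?nnegrE ?bpm_ge0 //.
have m0 : 0 < m.+1%:R :> rat by rewrite ltr0n.
by rewrite -(ler_pM2r m0) (le_trans (bpm_sqr_le m x)).
Qed.

Lemma exists_subset (T : finType) (A : {set T}) m :
  (m <= #|A|)%N -> exists2 P : {set T}, P \subset A & #|P| = m.
Proof.
rewrite -bin_gt0 -cards_draws => /card_gt0P[P]; rewrite inE => /andP[sP /eqP cP].
by exists P.
Qed.

Lemma card_trace (T : finType) (S A : {set T}) r : A \subset S -> (#|A| <= r)%N ->
  #|[set e : {set T} | (#|e| == r) && (e :&: S == A)]| = 'C(#|T| - #|S|, r - #|A|).
Proof.
move=> sAS leA; have <- : #|~: S| = (#|T| - #|S|)%N by rewrite cardsCs setCK.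
have dS (B : {set T}) : B \subset ~: S -> (A :|: B) :&: S = A.
  move=> sB; rewrite setIUl (setIidPl sAS); apply/setUidPl.
  have /eqP -> : B :&: S == set0 by rewrite setI_eq0 disjoints_subset.
  exact: sub0set.
have cU (B : {set T}) : B \subset ~: S -> #|A :|: B| = (#|A| + #|B|)%N.
  move=> sB; rewrite cardsU (_ : A :&: B = set0) ?cards0 ?subn0 //.
  apply/eqP; rewrite setI_eq0 disjoint_sym disjoints_subset.
  by rewrite (subset_trans sB) // setCS.
rewrite -cards_draws -[RHS](@card_in_imset _ _ (fun B => A :|: B)); last first.
  move=> B1 B2; rewrite !inE => /andP[s1 _] /andP[s2 _] /(congr1 (fun e => e :&: ~: S)).
  have AS : A :&: ~: S = set0 by apply/eqP; rewrite setI_eq0 disjoints_subset setCK.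
  by rewrite !setIUl AS !set0U (setIidPl s1) (setIidPl s2).
apply: eq_card => e; rewrite !inE; apply/andP/imsetP.
  move=> [/eqP ce /eqP eS]; exists (e :\: S); last by rewrite -eS setID.
  rewrite inE setDE subsetIr -setDE cardsD eS ce eqxx //.
move=> [B]; rewrite inE => /andP[sB /eqP cB] ->.
by rewrite dS // eqxx cU // cB subnKC.
Qed.

(** * Random uniform hypergraphs, and one weight for r at least 4 *)

Definition edges n r : {set {set 'I_n}} := [set e : {set 'I_n} | #|e| == r].

Lemma card_edges n r : #|edges n r| = 'C(n, r).
Proof. by rewrite card_draws card_ord. Qed.

Lemma almost_allI r (P : forall n, {set {set 'I_n}} -> bool) :
  (forall k : nat, (0 < k)%N -> exists N : nat, forall n, (N <= n)%N ->
     k%:R * mean (edges n r) (fun E => (~~ P n E)%:R) <= 1) ->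
  almost_all r P.
Proof.
move=> aaP k k0; have [N leN] := aaP k k0; exists N => n /leN.
rewrite /mean card_edges mulrA ler_pdivrMr ?exprn_gt0 // mul1r.
set c := #|_|; have -> : \sum_(E in powerset (edges n r)) (~~ P n E)%:R = c%:R :> rat.
  rewrite -natr_sum -big_mkcondr sum1_card; congr _%:R; apply: eq_card => E.
  rewrite !inE unfold_in powersetE; congr (_ && _).
  apply/subsetP/forall_inP => [sE e /sE|sE e /sE]; by rewrite inE.
by rewrite -natrM -natrX ler_nat.
Qed.

(** The weights are an arbitrary function into nat, so that degrees and threshold weights fall under
    the same lemmas. *)
Definition color n (w : {set 'I_n} -> nat) (E : {set {set 'I_n}}) (v : 'I_n) : nat :=
  \sum_(e in E | v \in e) w e.

Lemma color_setD n (w : {set 'I_n} -> nat) (E P : {set {set 'I_n}}) v :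
  (forall e, e \in P -> v \notin e) -> color w (E :\: P) v = color w E v.
Proof.
move=> vP; apply: eq_bigl => e; rewrite inE.
by case: (boolP (e \in P)) => //= /vP/negPf->; rewrite andbF.
Qed.

Lemma color_split n (w : {set 'I_n} -> nat) c (E P : {set {set 'I_n}}) v :
  (forall e, e \in P -> (v \in e) && (w e == c)) ->
  color w E v = (color w (E :\: P) v + c * #|E :&: P|)%N.
Proof.
move=> vP; rewrite /color (bigID (mem P)) addnC /=; congr (_ + _)%N; last first.
  by apply: eq_bigl => e; rewrite inE andbC andbA.
rewrite (eq_bigr (fun=> c)) => [|e /andP[_ /vP/andP[_ /eqP]]//].
rewrite sum_nat_const mulnC; congr (_ * _)%N; apply: eq_card => e.
rewrite inE unfold_in; case: (boolP (e \in P)) => [/vP/andP[->]|]; by rewrite ?andbT ?andbF.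
Qed.

(** Each u in l owns a set P of edges of one common weight c that avoid v and the rest of l. Given E
    outside P, the colour of u is a constant plus c times a binomial and has to hit the colour of v,
    which P does not affect; this costs one factor, and induction on l goes on with an event that
    ignores P. The reference vertex v owns nothing, hence the exponent [size l]. *)
Lemma prob_equal_colors n (w : {set 'I_n} -> nat) (K : {set {set 'I_n}}) m (v : 'I_n) l :
  uniq (v :: l) ->
  (forall u, u \in l -> exists c (P : {set {set 'I_n}}),
     [/\ (0 < c)%N, P \subset K, #|P| = m,
         forall e, e \in P -> (u \in e) && (w e == c) &
         forall e x, e \in P -> x \in v :: l -> x != u -> x \notin e]) ->
  mean K (fun E => (all (fun u => color w E u == color w E v) l)%:R) <=
  bpm m m./2 ^+ size l.
Proof.
elim: l => [|u l IH] /=; first by rewrite mean_cst.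
rewrite inE negb_or => /and3P[/andP[neq_vu vl] ul Ul] privP.
have {}IH := IH; rewrite /= vl Ul in IH.
have [c [P [c0 sPK cP uP xP]]] := privP u (mem_head _ _).
have vP e : e \in P -> v \notin e.
  by move=> Pe; apply: xP => //; rewrite mem_head.
have lP x e : x \in l -> e \in P -> x \notin e.
  move=> lx Pe; apply: xP => //; first by rewrite !inE lx !orbT.
  by apply: contraNneq ul => <-.
pose Q (A : {set {set 'I_n}}) := all (fun u => color w A u == color w A v) l.
have QD E : Q (E :\: P) = Q E.
  apply: eq_in_all => x lx; rewrite !color_setD // => e; exact: lP.
rewrite (mean_eq (g := fun E => (Q (E :\: P) &&
   (color w (E :\: P) u + c * #|E :&: P| == color w (E :\: P) v)%N)%:R)); last first.
  by move=> E _; rewrite -color_split // QD color_setD // andbC.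
apply: le_trans (@anticoncentration _ K P (bpm m m./2) c Q (color w ^~ u) (color w ^~ v) sPK c0 _) _.
  by move=> x; rewrite cP bpm_le_half.
rewrite exprS ler_wpM2l ?bpm_ge0 //.
rewrite (mean_eq (g := fun E => (Q E)%:R)) => [|E _]; last by rewrite QD.
apply: IH => // x lx; have [|c' [P' [? ? ? xP' yP']]] := privP x; first by rewrite inE lx orbT.
exists c', P'; split=> // e y P'e; rewrite inE => yl; apply: yP' => //.
by rewrite !inE; case/orP: yl => ->; rewrite ?orbT.
Qed.

(** The edges meeting the listed vertices only in u may carry both weights; the more frequent weight
    accounts for at least half of them, which explains the factor 2 in front of m. *)
Lemma prob_equal_colors_edges n r (w : {set 'I_n} -> nat) v l m :
  (0 < r)%N -> (forall e, (w e == 1%N) || (w e == 2%N)) -> uniq (v :: l) ->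
  (2 * m <= 'C(n - (size l).+1, r.-1))%N ->
  mean (edges n r) (fun E => (all (fun u => color w E u == color w E v) l)%:R) <=
  bpm m m./2 ^+ size l.
Proof.
move=> r0 w12 Ul le_m; apply: prob_equal_colors => // u lu.
pose S := [set x in v :: l].
have cS : #|S| = (size l).+1 by rewrite cardsE (card_uniqP Ul).
have uS : [set u] \subset S by rewrite sub1set inE inE lu orbT.
pose N c := [set e : {set 'I_n} | ((#|e| == r) && (e :&: S == [set u])) && (w e == c)].
have [c c0 leN] : exists2 c, (0 < c)%N & (m <= #|N c|)%N.
  have : (2 * m <= #|N 1%N| + #|N 2%N|)%N.
    apply: leq_trans le_m _; rewrite -cS -{1}(card_ord n).
    have := @card_trace _ S [set u] r uS; rewrite cards1 subn1 => <- //.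
    apply: leq_trans (leq_card_setU _ _); apply/subset_leq_card/subsetP => e.
    by rewrite !inE => ->; rewrite w12.
  by have [|lt1] := leqP m #|N 1%N|; [exists 1%N | exists 2%N => //; lia].
have [P sPN cP] := exists_subset leN.
exists c, P; split=> //.
- by apply: subset_trans sPN _; apply/subsetP => e; rewrite !inE => /andP[/andP[]].
- move=> e /(subsetP sPN); rewrite inE => /andP[/andP[_ /eqP/setP/(_ u)]].
  by rewrite !inE eqxx lu orbT andbT => -> ->.
- move=> e x /(subsetP sPN); rewrite inE => /andP[/andP[_ /eqP/setP/(_ x)]] + _ xl neq_xu.
  by rewrite in_setI [x \in S]inE xl andbT in_set1 (negPf neq_xu) => ->.
Qed.

Lemma bin_le_exp n r : ('C(n, r) <= n ^ r)%N.
Proof.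
apply: leq_trans (_ : n ^_ r <= _)%N.
  by rewrite -bin_ffact leq_pmulr ?fact_gt0.
elim: r => [|r IH] //; rewrite ffactnSr expnSr; apply: leq_mul => //; exact: leq_subr.
Qed.

Lemma bin_ge_exp n r : ((n - r) ^ r <= r ^ r * 'C(n, r))%N.
Proof.
apply: leq_trans (_ : n ^_ r <= _)%N.
  suff H s t : (s <= t -> (n - t) ^ s <= n ^_ s)%N by exact: H.
  elim: s t => [|s IH] t //; rewrite ffactnSr expnSr => lt_st.
  by apply: leq_mul; [apply: IH; exact: ltnW | apply: leq_sub2l; exact: ltnW].
rewrite -bin_ffact mulnC leq_mul2r; apply/orP; right.
elim: r => // r IH; rewrite factS expnS leq_mul2l /=.
by apply: leq_trans IH _; case: r => // r; rewrite leq_exp2r.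
Qed.

Lemma weakly_weightedN n (E : {set {set 'I_n}}) k (om : {ffun {set 'I_n} -> 'I_k.+1}) r :
  E \subset edges n r -> ~~ weakly_weighted E k.+1 ->
  exists2 e, e \in edges n r & monochromatic E om e.
Proof.
move=> sE; rewrite negb_exists => /forallP/(_ om).
rewrite negb_forall => /existsP[e]; rewrite negb_imply negbK => /andP[Ee me].
by exists e => //; exact: (subsetP sE).
Qed.

Lemma bpm_half_sqr m : bpm m m./2 ^+ 2 * m%:R <= 1.
Proof.
apply: le_trans (bpm_sqr_le m m./2); rewrite ler_wpM2l ?sqr_ge0 //.
by rewrite ler_nat.
Qed.

Lemma ler_bool (a b : bool) : (a -> b) -> a%:R <= b%:R :> rat.
Proof. by case: a; case: b => // /(_ isT). Qed.

Lemma ler_sum_bool (I : finType) (b : bool) (A : {set I}) (Q : I -> bool) :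
  (b -> exists2 i, i \in A & Q i) -> b%:R <= \sum_(i in A) (Q i)%:R :> rat.
Proof.
case: b => [[//|i Ai Qi]|_]; last by apply: sumr_ge0 => i _; exact: ler0n.
by rewrite (bigD1 i) //= Qi lerDl; apply: sumr_ge0 => j _; exact: ler0n.
Qed.

Lemma almost_all_weighted1 r : (4 <= r)%N -> almost_all r (fun n E => weakly_weighted E 1).
Proof.
move=> r4; apply: almost_allI => k k0.
(* [bin_ge_exp] gives (r-1)^(r-1), and n is at most twice n - 4 - (r-1); hence n^(r-1) <= c N
   below. *)
pose c := ((2 * r.-1) ^ r.-1)%N.
have c0 : (0 < c)%N by rewrite expn_gt0; apply/orP; left; lia.
exists ((8 * c) ^ 3 * k ^ 2 + 2 * r + 16 + c)%N => n le_n.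
pose N := 'C(n - 4, r.-1); pose m := N./2.
have leN : (n ^ r.-1 <= c * N)%N.
  rewrite /c /N expnMn -mulnA; apply: leq_trans (leq_mul (leqnn _) (bin_ge_exp _ _)).
  by rewrite -expnMn leq_exp2r; lia.
have nc : (c < N)%N.
  rewrite -(ltn_pmul2l c0); apply: leq_trans leN; apply: leq_trans (_ : n ^ 3 <= _)%N.
    have : (c * c <= n * n)%N by apply: leq_mul; lia.
    rewrite !expnS expn0; nia.
  by rewrite leq_pexp2l; lia.
have le4 : (n ^ r.-1 <= 4 * c * m)%N.
  apply: leq_trans leN _; rewrite (mulnC 4%N) -mulnA leq_mul2l /m; apply/orP; right.
  by have := odd_double_half N; lia.
pose om : {ffun {set 'I_n} -> 'I_1} := [ffun=> ord0].
pose w (e : {set 'I_n}) := (om e).+1.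
pose X (e : {set 'I_n}) (E : {set {set 'I_n}}) : bool := monochromatic E om e.
have leX e : e \in edges n r -> mean (edges n r) (fun E => (X e E)%:R) <= bpm m m./2 ^+ 3.
  rewrite inE => /eqP ce; have Ue := enum_uniq (mem e).
  have : size (enum e) = r by rewrite -cardE.
  case Ee: (enum e) => [|v [|u1 [|u2 [|u3 s]]]] /= sz; try by exfalso; lia.
  pose l := [:: u1; u2; u3].
  have Ul : uniq (v :: l).
    by move: Ue; rewrite Ee -[_ :: _]/((v :: l) ++ s) cat_uniq => /andP[].
  have le x : x \in v :: l -> x \in e.
    by rewrite -(mem_enum e) Ee -[_ :: _ in X in _ -> X]/((v :: l) ++ s) mem_cat => ->.
  apply: le_trans (@prob_equal_colors_edges n r w v l m _ _ Ul _).
  - apply: mean_le => E _; apply: ler_bool => /forall_inP me.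
    apply/allP => u lu; have vu : u \in v :: l by rewrite inE lu orbT.
    have /forall_inP/(_ v) := me u (le u vu).
    exact: (fun H => H (le v (mem_head _ _))).
  - by lia.
  - by move=> e'; rewrite /w /om ffunE.
  - by rewrite /= -/N /m; have := odd_double_half N; lia.
apply: (@le_trans _ _ (k%:R * ('C(n, r)%:R * bpm m m./2 ^+ 3))).
  rewrite ler_wpM2l ?ler0n // -card_edges mulr_natl -sumr_const.
  apply: le_trans (_ : mean (edges n r) (fun E => \sum_(e in edges n r) (X e E)%:R) <= _).
    by apply: mean_le => E sE; apply: ler_sum_bool => /(weakly_weightedN om sE).
  by rewrite mean_sum; apply: ler_sum.
have m0 : (0 < m)%N by rewrite /m; have := odd_double_half N; lia.
(* The required k C(n, r) <= m^(3/2), squared. It reduces to n^(2r+1) <= n^(3(r-1)), where r >= 4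
   enters; the spare factor n absorbs k and the constants. *)
have le_kC : ((k * 'C(n, r)) ^ 2 <= m ^ 3)%N.
  have c3 : (0 < (4 * c) ^ 3)%N by rewrite expn_gt0 muln_gt0 c0.
  rewrite -(leq_pmul2l c3) -expnMn.
  apply: leq_trans (_ : (n ^ r.-1) ^ 3 <= _)%N; last by rewrite leq_exp2r.
  apply: leq_trans (_ : (4 * c) ^ 3 * (k ^ 2 * (n ^ r) ^ 2) <= _)%N.
    by rewrite [((k * _) ^ 2)%N]expnMn leq_mul2l leq_mul2l leq_exp2r // bin_le_exp !orbT.
  rewrite mulnA -!expnM.
  apply: leq_trans (_ : n * n ^ (r * 2) <= _)%N; last first.
    by rewrite -expnS leq_pexp2l; clear -r4 le_n; lia.
  apply: leq_mul => //; apply: leq_trans le_n.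
  apply: leq_trans (_ : (8 * c) ^ 3 * k ^ 2 <= _)%N; last by lia.
  by rewrite leq_mul2r leq_exp2r // leq_mul2r !orbT.
set b := bpm m m./2; have b0 : 0 <= b := bpm_ge0 _ _.
have t0 : 0 <= k%:R * ('C(n, r)%:R * b ^+ 3)
  by exact: mulr_ge0 (ler0n _ _) (mulr_ge0 (ler0n _ _) (exprn_ge0 _ b0)).
rewrite -[X in X <= _]ger0_norm // -[X in _ <= X]normr1 -ler_sqr ?nnegrE ?normr_ge0 //.
rewrite !real_normK ?num_real // expr1n.
have M0 : 0 < m%:R ^+ 3 :> rat by rewrite exprn_gt0 // ltr0n.
rewrite -(ler_pM2r M0) mul1r.
have -> : (k%:R * ('C(n, r)%:R * b ^+ 3)) ^+ 2 * m%:R ^+ 3 =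
  (k * 'C(n, r))%:R ^+ 2 * (b ^+ 2 * m%:R) ^+ 3 by rewrite natrM; ring.
have bm : 0 <= b ^+ 2 * m%:R <= 1 by rewrite bpm_half_sqr mulr_ge0 ?sqr_ge0.
apply: le_trans (_ : (k * 'C(n, r))%:R ^+ 2 <= _); last by rewrite -!natrX ler_nat.
by case/andP: bm => bm0 bm1; rewrite ler_piMr ?sqr_ge0 // exprn_ile1.
Qed.

(** * Two weights for r = 3: the exponential moment *)

Lemma bernoulli (x : rat) m : -1 <= x -> 1 + m%:R * x <= (1 + x) ^+ m.
Proof.
move=> x1; elim: m => [|m IH]; first by rewrite expr0 mul0r addr0.
have x0 : 0 <= 1 + x by lra.
rewrite exprS; apply: le_trans (ler_wpM2l x0 IH).
have m0 : 0 <= m%:R :> rat := ler0n _ _.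
by rewrite -natr1; nra.
Qed.

(** Bernoulli's inequality for 1/(1 + x) = 1 - y, where y <= x. *)
Lemma pow_one_plus_mul_le (x : rat) m : 0 <= x -> (1 + x) ^+ m * (1 - m%:R * x) <= 1.
Proof.
move=> x0; pose y := x / (1 + x).
have x1 : 0 < 1 + x by lra.
have y0 : 0 <= y by rewrite divr_ge0 // ltW.
have yx : y <= x by rewrite ler_pdivrMr //; nra.
have Ey : 1 - y = (1 + x)^-1 by rewrite /y; field; lra.
have y1 : -1 <= - y by rewrite lerN2 ler_pdivrMr //; lra.
have := bernoulli m y1; rewrite Ey exprVn => leb.
have m0 : 0 <= m%:R :> rat := ler0n _ _.
have p0 : 0 < (1 + x) ^+ m by rewrite exprn_gt0.
rewrite mulrC -ler_pdivlMr // mul1r; apply: le_trans leb.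
by rewrite lerD2l mulrN lerN2 ler_wpM2l.
Qed.

Lemma pow_one_plus_le (x : rat) m : 0 <= x -> 2 * m%:R * x <= 1 -> (1 + x) ^+ m <= 2.
Proof.
move=> x0 mx; have le1 := pow_one_plus_mul_le m x0.
have p0 : 0 <= (1 + x) ^+ m by rewrite exprn_ge0 // addr_ge0.
by nra.
Qed.

Lemma pow_one_minus_le (x : rat) m l :
  0 <= x <= 1 -> 1 <= m%:R * x -> (1 - x) ^+ (m * l) <= 2 ^- l.
Proof.
move=> /andP[x0 x1] mx; rewrite exprM -exprVn lerXn2r ?nnegrE ?exprn_ge0 ?subr_ge0 //.
have x2 : -1 <= x by lra.
have le2 : 2 <= (1 + x) ^+ m by apply: le_trans (bernoulli m x2); lra.
have le1 : (1 - x) ^+ m * (1 + x) ^+ m <= 1.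
  by rewrite -exprMn exprn_ile1 //; nra.
have y0 : 0 <= (1 - x) ^+ m by rewrite exprn_ge0 // subr_ge0.
have := le_trans (ler_wpM2l y0 le2) le1; lra.
Qed.

(** Markov's inequality for p^(c(i) - c(k)): this is 1 when the colours agree, and its mean factors
    because it is a product over independent edges. *)
Lemma prob_eq_color_tilt n (w : {set 'I_n} -> nat) (K : {set {set 'I_n}}) (p : rat) i k :
  0 < p ->
  mean K (fun E => (color w E i == color w E k)%:R) <=
  \prod_(e in K) ((1 + (if i \in e then p ^+ w e else 1) / (if k \in e then p ^+ w e else 1)) / 2).
Proof.
move=> p0.
pose g v (e : {set _}) : rat := if v \in e then p ^+ w e else 1.
have pow_color v (E : {set {set 'I_n}}) : E \subset K ->
    p ^+ color w E v = \prod_(e in K) (if e \in E then g v e else 1).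
  move=> sEK; rewrite /color -prodrXr big_mkcondr /= [RHS](big_setID E) /= (setIidPr sEK).
  rewrite [X in _ = _ * X]big1 ?mulr1 => [|e]; last by rewrite inE => /andP[/negPf-> _].
  by apply: eq_bigr => e ->.
pose phi (e : {set _}) (b : bool) : rat := if b then g i e / g k e else 1.
have -> : \prod_(e in K) ((1 + g i e / g k e) / 2) =
          \prod_(e in K) ((phi e false + phi e true) / 2) by [].
rewrite -mean_prod; apply: mean_le => E sEK.
have -> : \prod_(t in K) phi t (t \in E) = p ^+ color w E i / p ^+ color w E k.
  rewrite !pow_color // -prodf_div; apply: eq_bigr => e _; rewrite /phi.
  by case: ifP => // _; rewrite divr1.
by case: eqP => [->|_]; [rewrite divff // expf_neq0 // gt_eqF | rewrite divr_ge0 ?exprn_ge0 // ltW].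
Qed.

Definition swap_set n (i k : 'I_n) (e : {set 'I_n}) : {set 'I_n} := tperm i k @: e.

Lemma swap_setK n (i k : 'I_n) : involutive (swap_set i k).
Proof.
move=> e; rewrite /swap_set -imset_comp -[RHS]imset_id; apply: eq_imset => x /=.
exact: tpermK.
Qed.

Lemma mem_swap_set n (i k : 'I_n) e v : (v \in swap_set i k e) = (tperm i k v \in e).
Proof. by rewrite -{1}(tpermK i k v) mem_imset //; exact: perm_inj. Qed.

Lemma card_swap_set n (i k : 'I_n) e : #|swap_set i k e| = #|e|.
Proof. by rewrite card_imset //; exact: perm_inj. Qed.

(* Pairing e with the edge in which i is replaced by k turns the product into one over the edges
  through i only. *)
Lemma prob_eq_color_pairing n r (w : {set 'I_n} -> nat) (p : rat) i k :
  0 < p -> i != k ->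
  mean (edges n r) (fun E => (color w E i == color w E k)%:R) <=
  \prod_(e in edges n r | (i \in e) && (k \notin e))
     ((1 + p ^+ w e) * (1 + p ^- w (swap_set i k e)) / 4).
Proof.
move=> p0 neq_ik; apply: le_trans (prob_eq_color_tilt w (edges n r) i k p0) _.
set G := BIG_F; rewrite (bigID (fun e : {set _} => (i \in e) && (k \notin e))) /=.
rewrite [X in _ * X <= _](bigID (fun e : {set _} => (k \in e) && (i \notin e))) /=.
(* Edges containing both or neither of i and k contribute the factor 1. *)
rewrite [X in _ * (_ * X) <= _]big1 ?mulr1; last first.
  move=> e /andP[/andP[_ H1] H2]; rewrite /G; move: H1 H2.
  case: (i \in e); case: (k \in e) => //= _ _; rewrite divff ?expf_neq0 ?gt_eqF //.
rewrite [X in _ * X <= _](reindex_inj (inv_inj (@swap_setK n i k))) /=.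
rewrite [X in _ * X <= _](eq_bigl (fun e => (e \in edges n r) && ((i \in e) && (k \notin e)))).
  rewrite -big_split /= le_eqVlt; apply/orP; left; apply/eqP.
  apply: eq_bigr => e /andP[_ /andP[ie ke]]; rewrite /G !mem_swap_set tpermL tpermR.
  by rewrite ie (negPf ke) divr1 div1r mulrACA -invfM -natrM.
move=> e; rewrite !inE card_swap_set !mem_swap_set tpermL tpermR.
by case: (_ == _); case: (i \in e); case: (k \in e).
Qed.

(** With equal weights the first-order terms in x cancel and the factor is 1 + O(x^2); with
    different weights it is 1 - x/2 + O(x^2). The constant 16 makes 1 - x/16 valid up to x = 1,
    where both sides of that bound are 15/16. *)
Lemma pair_factor_le (x : rat) a b : 0 <= x <= 1 ->
  (a == 1%N) || (a == 2%N) -> (b == 1%N) || (b == 2%N) -> (a <= b)%N ->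
  (1 + (1 + x) ^+ a) * (1 + (1 + x) ^- b) / 4 <=
  (1 + x ^+ 2) * (if (a < b)%N then 1 - x / 16 else 1).
Proof.
move=> /andP[x0 x1]; have p0 : 0 < 1 + x by lra.
case/orP=> /eqP->; case/orP=> /eqP-> // _; rewrite /= ?expr1 ?mulr1.
- have -> : (1 + (1 + x)) * (1 + (1 + x)^-1) / 4 = (2 + x) ^+ 2 / (4 * (1 + x)) by field; lra.
  by rewrite ler_pdivrMr; nra.
- apply: (@le_trans _ _ (1 - x / 16)); last by nra.
  have -> : (1 + (1 + x)) * (1 + (1 + x) ^- 2) / 4 =
    (2 + x) * (1 + (1 + x) ^+ 2) / (4 * (1 + x) ^+ 2) by field; lra.
  by rewrite ler_pdivrMr; nra.
- have -> : (1 + (1 + x) ^+ 2) * (1 + (1 + x) ^- 2) / 4 =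
    (1 + (1 + x) ^+ 2) ^+ 2 / (4 * (1 + x) ^+ 2) by field; lra.
  rewrite ler_pdivrMr; last by nra.
  rewrite -subr_ge0 (_ : _ - _ = x ^+ 3 * (4 + 3 * x)); last by ring.
  by rewrite mulr_ge0 ?exprn_ge0; lra.
Qed.

(** The tilt is p = 1 + 1/n. The second-order losses (1 + n^-2) over at most n^2/2 pairs multiply to
    at most 2, while every 16 n pairs with different weights gain a factor (1 - 1/(16 n))^(16 n) <=
    1/2. *)
Lemma prob_eq_color_far n r (w : {set 'I_n} -> nat) (i k : 'I_n) l :
  (0 < n)%N -> i != k -> (2 * 'C(n - 2, r.-1) <= n ^ 2)%N -> (0 < r)%N ->
  (forall e, (w e == 1%N) || (w e == 2%N)) ->
  (forall e : {set 'I_n}, i \in e -> k \notin e -> (w e <= w (swap_set i k e))%N) ->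
  (16 * n * l <= #|[set e in edges n r | [&& i \in e, k \notin e & (w e < w (swap_set i k e))%N]]|)%N ->
  mean (edges n r) (fun E => (color w E i == color w E k)%:R) <= 2 * 2 ^- l.
Proof.
move=> n0 neq_ik leM r0 w12 wmono; set D := [set e in _ | _] => leD.
pose x : rat := n%:R^-1.
have N0 : 0 < n%:R :> rat by rewrite ltr0n.
have x0 : 0 < x by rewrite invr_gt0.
have x1 : x <= 1 by rewrite invf_le1 // ler1n.
have x01 : 0 <= x <= 1 by rewrite ltW.
have p0 : 0 < 1 + x by rewrite addr_gt0.
apply: le_trans (prob_eq_color_pairing r w p0 neq_ik) _.
apply: le_trans (_ : \prod_(e in edges n r | (i \in e) && (k \notin e))
   ((1 + x ^+ 2) * (if (w e < w (swap_set i k e))%N then 1 - x / 16 else 1)) <= _).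
  apply: ler_prod => e /andP[_ /andP[ie ke]]; apply/andP; split.
    by rewrite !divr_ge0 ?mulr_ge0 ?addr_ge0 ?invr_ge0 ?exprn_ge0 // ltW.
  by apply: pair_factor_le => //; apply: wmono.
rewrite big_split /= -big_mkcondr /= prodr_const.
rewrite (eq_bigl (mem D)) => [|e]; last by rewrite !inE -!andbA.
rewrite prodr_const.
have cM : #|(fun e : {set 'I_n} => (e \in edges n r) && ((i \in e) && (k \notin e)))| = 'C(n - 2, r.-1).
  have := @card_trace _ [set i; k] [set i] r; rewrite cards2 neq_ik cards1 card_ord subn1 => <- //.
    apply: eq_card => e; rewrite !inE unfold_in inE; congr (_ && _).
    apply/andP/eqP => [[ie ke]|/setP H].
      apply/setP => y; rewrite !inE; case: (eqVneq y i) => [->|neq_yi]; first by rewrite ie.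
      by case: (eqVneq y k) => [->|]; rewrite ?(negPf ke) ?andbF.
    have := H i; have := H k; rewrite !inE !eqxx orbT andbT eq_sym (negPf neq_ik) => -> /=.
    by rewrite andbT => ->.
  by rewrite sub1set !inE eqxx.
rewrite cM; apply: ler_pM.
- by rewrite exprn_ge0 // addr_ge0 // exprn_ge0 // ltW.
- by rewrite exprn_ge0 //; lra.
- apply: pow_one_plus_le; first by rewrite exprn_ge0 // ltW.
  have -> : x ^+ 2 = (n%:R ^+ 2)^-1 by rewrite exprVn.
  by rewrite ler_pdivrMr ?exprn_gt0 // mul1r -natrM -natrX ler_nat.
- have y01 : 0 <= x / 16 <= 1 by lra.
  apply: le_trans (_ : (1 - x / 16) ^+ (16 * n * l) <= _).
    by apply: ler_wiXn2l => //; lra.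
  apply: pow_one_minus_le => //; rewrite natrM /x.
  by have -> : 16 * n%:R * (n%:R^-1 / 16) = 1 :> rat by field; rewrite gt_eqF.
Qed.

(** * The threshold weighting *)

Definition index_sum n (e : {set 'I_n}) : nat := \sum_(x in e) x.

(** Depending on the index sum alone, the weight never drops when a vertex is exchanged for a later
    one, as [prob_eq_color_far] demands. *)
Definition threshold_weight n (t : nat) (e : {set 'I_n}) : nat :=
  if (t <= index_sum e)%N then 2 else 1.

Lemma index_sum_swap n (i k : 'I_n) (e : {set 'I_n}) : i \in e -> k \notin e ->
  (index_sum (swap_set i k e) + i = index_sum e + k)%N.
Proof.
move=> ie ke; rewrite /index_sum /swap_set big_imset /=; last by move=> ? ? _ _; exact: perm_inj.
rewrite (bigD1 i) //= [X in (_ = X + k)%N](bigD1 i) //= tpermL.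
rewrite (eq_bigr (fun x : 'I_n => x : nat)); first by lia.
move=> x /andP[ex neq_xi]; rewrite tpermD // eq_sym //.
by apply: contraNneq ke => <-.
Qed.

Lemma card_le_fst (d q : nat) (A : {set 'I_d * 'I_q}) : {in A &, injective fst} -> (#|A| <= d)%N.
Proof. by move=> /card_in_imset <-; apply: leq_trans (max_card _) _; rewrite card_ord. Qed.

(* Exchanging i for k crosses the threshold for e = {i, a, b} exactly when t - k <= a + b < t - i;
   each of these k - i sums is realised by at least q - 5 pairs {a, b}. *)
Lemma card_crossing n q (i k : 'I_n) : (i < k)%N -> (2 <= q)%N -> (4 * q <= n)%N ->
  ((k - i) * (q - 5) <= let w := threshold_weight (n + 2 * q) in
   #|[set e in edges n 3 | [&& i \in e, k \notin e & (w e < w (swap_set i k e))%N]]|)%N.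
Proof.
move=> lt_ik q2 le_qn; have ltk := ltn_ord k.
case: n i k lt_ik le_qn ltk => [|n] i k lt_ik le_qn ltk; first by case: (i) => m.
set w := threshold_weight _; pose t := (n.+1 + 2 * q)%N => /=.
pose d := (k - i)%N; pose q' := q.-1.
(* Now n is the largest index. The first coordinate selects the sum s in [t - k, t - i), the second
   the smaller vertex a, counted from max(0, s - n), the least value keeping s - a at most n;
   truncated subtraction supplies the maximum. Fewer than q choices keep a below s - a. *)
pose s (p : 'I_d * 'I_q') : nat := (t - k + p.1)%N.
pose a (p : 'I_d * 'I_q') : nat := (s p - n + p.2)%N.
pose b (p : 'I_d * 'I_q') : nat := (s p - a p)%N.
have bnd p : [/\ (a p < b p)%N, (b p < n.+1)%N, (a p + b p = s p)%N & (t - k <= s p < t - i)%N].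
  rewrite /b /a /s; have := ltn_ord p.1; have := ltn_ord p.2; rewrite /d /q' /t in ltk *.
  by move=> H1 H2; split; lia.
(* The pairs colliding with i or k. Each of the four coincidences determines the second coordinate
   from the first, so at most 4 d pairs are lost and (q - 1) - 4 = q - 5 survive per sum. *)
pose B := [set p | [|| a p == i, a p == k, b p == i | b p == k]].
pose f p : {set 'I_n.+1} := [set i; inord (a p); inord (b p)].
have cB : (#|B| <= 4 * d)%N.
  pose Bx (g : 'I_d * 'I_q' -> nat) (x : 'I_n.+1) := [set p | g p == x].
  have sB : B \subset (Bx a i :|: Bx a k) :|: (Bx b i :|: Bx b k).
    by apply/subsetP => p; rewrite !inE -!orbA.
  have cBa x : (#|Bx a x| <= d)%N.
    apply: card_le_fst => -[x1 y1] [x2 y2]; rewrite !inE /a /s /= => E1 E2 Ex.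
    by congr (_, _); [|apply/val_inj] => //=; rewrite -Ex in E2; lia.
  have cBb x : (#|Bx b x| <= d)%N.
    apply: card_le_fst => p1 p2; rewrite !inE => E1 E2 Ex.
    have [_ _ S1 _] := bnd p1; have [_ _ S2 _] := bnd p2.
    case: p1 p2 Ex E1 E2 S1 S2 => [x1 y1] [x2 y2]; rewrite /a /s /= => <- E1 E2 S1 S2.
    by congr (_, _); apply/val_inj => /=; lia.
  apply: leq_trans (subset_leq_card sB) _.
  apply: leq_trans (leq_card_setU _ _) _.
  have := (leq_card_setU (Bx a i) (Bx a k)).1; have := (leq_card_setU (Bx b i) (Bx b k)).1.
  by move: (cBa i) (cBa k) (cBb i) (cBb k); lia.
have mem_f p (v : 'I_n.+1) : (v \in f p) = [|| v == i, val v == a p | val v == b p].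
  have [? ? _ _] := bnd p; rewrite !inE -orbA -!val_eqE /= !inordK //; lia.
have notB p : p \in ~: B -> [/\ a p != i, a p != k, b p != i & b p != k].
  by rewrite !inE !negb_or => /and4P.
have inj_f : {in ~: B &, injective f}.
  move=> p1 p2 /notB[ai1 _ bi1 _] /notB[ai2 _ bi2 _] Ef.
  have [ab1 bn1 S1 _] := bnd p1; have [ab2 bn2 S2 _] := bnd p2.
  have an1 : (a p1 < n.+1)%N by lia.
  have := mem_f p2 (Ordinal an1); have := mem_f p2 (Ordinal bn1).
  rewrite -Ef !mem_f -!val_eqE /= !eqxx !orbT (negPf ai1) (negPf bi1) /=.
  move=> /esym Hb /esym Ha; have [Ea Eb] : a p1 = a p2 /\ b p1 = b p2 by lia.
  have Es : s p1 = s p2 by rewrite -S1 -S2 Ea Eb.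
  case: p1 p2 Ea Es {S1 S2 Ef ai1 bi1 ai2 bi2 ab1 bn1 ab2 bn2 an1 Hb Ha Eb} => [x1 y1] [x2 y2].
  rewrite /a => Ea Es; rewrite Es in Ea; move: Es; rewrite /s /= => Es.
  by congr (_, _); apply/val_inj => /=; [lia | move: Ea => /=; lia].
have cC : (d * (q - 5) <= #|~: B|)%N.
  have := cardsC B; rewrite card_prod !card_ord.
  have [le5|lt5] := leqP 5 q; last by rewrite (_ : q - 5 = 0)%N ?muln0 //; lia.
  have Eq : (d * q' = d * (q - 5) + 4 * d)%N by rewrite (mulnC 4%N) -mulnDr /q'; congr (_ * _)%N; lia.
  by rewrite Eq; lia.
apply: leq_trans cC _; rewrite -(card_in_imset inj_f).
apply/subset_leq_card/subsetP => e /imsetP[p pB ->].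
have [ai ak bi bk] := notB _ pB; have [ltab ltb Sp /andP[ts st]] := bnd p.
have lta : (a p < n.+1)%N by lia.
have neqs : (i \notin [set inord (a p); inord (b p) : 'I_n.+1]) && (inord (a p) != inord (b p) :>
  'I_n.+1).
  by rewrite !inE -!val_eqE /= !inordK // (eq_sym (i : nat) (a p)) (eq_sym (i : nat) (b p)) negb_or
    ai bi ltn_eqF.
have {neqs} [n1 n2] := andP neqs.
have n3 : inord (a p) \notin [set inord (b p) : 'I_n.+1] by rewrite inE.
have ifp : i \in f p by rewrite mem_f eqxx.
have kfp : k \notin f p by rewrite mem_f -!val_eqE /=; lia.
have sfp : index_sum (f p) = (i + s p)%N.
  by rewrite /index_sum /f -setUA big_setU1 // big_setU1 // big_set1 -Sp !inordK.
rewrite in_set ifp kfp /w /threshold_weight.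
have := index_sum_swap ifp kfp; rewrite sfp => Esw.
have -> : (t <= i + s p)%N = false by lia.
have -> : (t <= index_sum (swap_set i k (f p)))%N by lia.
by rewrite in_set /f -setUA cardsU1 n1 cardsU1 n3 cards1.
Qed.

(** * Two weights for r = 3: the union bound *)

Lemma bin_le_pow2 n k : ('C(n, k) <= 2 ^ n)%N.
Proof.
elim: n k => [|n IH] [|k] //; first by rewrite bin0 expn_gt0.
by rewrite binS expnS mul2n -addnn leq_add.
Qed.

(** From C(u, 3) <= 2^u one gets u^3 <= 6^3 2^u <= 432 n for u = 1 + floor(log2 n), and one factor u
    exceeds 432 C once n is large. *)
Lemma sqr_log_le C : exists N : nat, forall n, (N <= n)%N ->
  (C * (trunc_log 2 n).+1 ^ 2 <= n)%N.
Proof.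
exists (2 ^ (432 * C + 6))%N => n le_n.
have n0 : (0 < n)%N by apply: leq_trans le_n; rewrite expn_gt0.
set u := (trunc_log 2 n).+1.
have lt_nu : (n < 2 ^ u)%N by exact: trunc_log_ltn.
have le_un : (2 ^ u <= 2 * n)%N by rewrite expnS leq_mul2l trunc_logP.
have u_ge : (432 * C + 6 < u)%N.
  by rewrite -(@ltn_exp2l 2) //; apply: leq_ltn_trans le_n lt_nu.
have bu : (u ^ 3 <= 216 * 2 ^ u)%N.
  have le_b := leq_trans (bin_ge_exp u 3) (leq_mul (leqnn (3 ^ 3)) (bin_le_pow2 u 3)).
  apply: leq_trans (_ : (2 * (u - 3)) ^ 3 <= _)%N; first by rewrite leq_exp2r //; lia.
  rewrite expnMn (_ : 216 = 2 ^ 3 * 3 ^ 3)%N // -mulnA leq_mul2l; exact: le_b.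
have : (432 * C * u ^ 2 <= 432 * n)%N.
  apply: leq_trans (_ : u ^ 3 <= _)%N; first by rewrite (expnS u 2) leq_mul2r; apply/orP; right; lia.
  apply: leq_trans bu _; lia.
by rewrite -mulnA leq_mul2l.
Qed.

Lemma edges3P n (e : {set 'I_n}) : e \in edges n 3 ->
  exists x y z, uniq [:: x; y; z] /\ e = [set x; y; z].
Proof.
rewrite inE cardE => sz; have := enum_uniq e.
case Ee: (enum e) sz => [|x [|y [|z [|? ?]]]] //= _ U; exists x, y, z; split => //.
by apply/setP => v; rewrite -(mem_enum e) Ee !inE orbA.
Qed.

Lemma two_mul_bin2 m : (2 * 'C(m, 2) = m * m.-1)%N.
Proof. by rewrite -(mul_bin_diag m 1) bin1. Qed.

Lemma natr_orb_le (a b : bool) : (a || b)%:R <= a%:R + b%:R :> rat.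
Proof. by case: a; case: b. Qed.

(* A monochromatic edge contains a pair at distance at least L = 384 log n, or lies within distance L;
   there are only O(n L^2) edges of the second kind, each monochromatic with probability O(n^-2). *)
Lemma prob_not_weakly_weighted2 k : exists N : nat, forall n, (N <= n)%N ->
  k%:R * mean (edges n 3) (fun E => (~~ weakly_weighted E 2)%:R) <= 1.
Proof.
have [N0 le_N0] := sqr_log_le (32 * k * 769 ^ 2).
exists (N0 + 4 * k + 200)%N => n le_n.
have {le_N0} := le_N0 n; set u := (trunc_log 2 n).+1 => le_u.
have {}le_u : (32 * k * (769 * u) ^ 2 <= n)%N by rewrite expnMn mulnA le_u //; lia.
have lt_nu : (n < 2 ^ u)%N by exact: trunc_log_ltn.
have u0 : (0 < u)%N by [].
have nearP a b c : (b + c <= a)%N = false -> (a + c <= b)%N = false ->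
    (b < a + c)%N && (a < b + c)%N by clear; lia.
(* Since n < 2^u, the choice l = 3 u gives 2^-l < n^-3 against at most n^2 pairs. As n <= 8 (q - 5),
   taking L = 128 l provides the L (q - 5) >= 16 n l crossing edges required by [prob_eq_color_far].
   The threshold n + 2 q is near 3n/2, the average index sum of a triple. *)
clearbody u; pose l := (3 * u)%N; pose L := (128 * l)%N; pose q := (n %/ 4)%N.
pose w : {set 'I_n} -> nat := threshold_weight (n + 2 * q).
pose om : {ffun {set 'I_n} -> 'I_2} := [ffun e => inord (w e).-1].
pose m := ('C(n - 3, 2))./2.
have w12 e : (w e == 1%N) || (w e == 2%N) by rewrite /w /threshold_weight; case: ifP.
have om_w e : (om e).+1 = w e.
  by rewrite ffunE inordK; case/orP: (w12 e) => /eqP->.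
pose far := [set p : 'I_n * 'I_n | (p.1 + L <= p.2)%N].
pose near (i j : 'I_n) := (j < i + L)%N && (i < j + L)%N.
pose close := [set p : 'I_n * 'I_n * 'I_n |
  [&& uniq [:: p.1.1; p.1.2; p.2], near p.1.1 p.1.2 & near p.1.1 p.2]].
pose eqc (E : {set {set 'I_n}}) (i j : 'I_n) := color w E i == color w E j.
have le_mono (E : {set {set 'I_n}}) : E \subset edges n 3 ->
  (~~ weakly_weighted E 2)%:R <= \sum_(p in far) (eqc E p.1 p.2)%:R +
    \sum_(p in close) (all (fun v => eqc E v p.1.1) [:: p.1.2; p.2])%:R :> rat.
  move=> sE; case: (boolP (weakly_weighted E 2)) => /= [_|/(weakly_weightedN om sE)[e e3 me]].
    by rewrite addr_ge0 // sumr_ge0 // => p _; rewrite ler0n.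
  have eqE x y : x \in e -> y \in e -> eqc E x y.
    move=> ex ey; have /forall_inP/(_ y ey) := (forall_inP me) x ex.
    suff col v : induced_color E om v = color w E v by rewrite !col.
    by apply: eq_bigr => f _; exact: om_w.
  have [x [y [z [U Ee]]]] := edges3P e3.
  have [ex ey ez] : [/\ x \in e, y \in e & z \in e] by rewrite Ee !inE !eqxx !orbT.
  have [p /andP[fp ep]|nofar] :=
      pickP (fun p => (p \in far) && eqc E p.1 p.2).
    rewrite -[1]addr0 lerD //; last by apply: sumr_ge0 => ? _; rewrite ler0n.
    by apply: (@ler_sum_bool _ true) => _; exists p.
  have nearE a b : a \in e -> b \in e -> near a b.
    move=> ea eb; have := nofar (a, b); have := nofar (b, a).
    by rewrite !inE /= !eqE // !andbT; exact: nearP.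
  rewrite -[1]add0r lerD //; first by apply: sumr_ge0 => ? _; rewrite ler0n.
  apply: (@ler_sum_bool _ true) => _; exists (x, y, z).
    by rewrite inE U !nearE.
  by rewrite /= !eqE.
have le_far p : p \in far -> mean (edges n 3) (fun E => (eqc E p.1 p.2)%:R) <= 2 * 2 ^- l.
  rewrite inE => le_p; have lt12 : (p.1 < p.2)%N.
    by apply: leq_trans le_p; rewrite -addn1 leq_add2l /L /l !muln_gt0 u0.
  apply: prob_eq_color_far => //; first by lia.
  - by rewrite -val_eqE /=; lia.
  - by rewrite two_mul_bin2 -mulnn leq_mul //; lia.
  - move=> e ie ke; have := index_sum_swap ie ke; rewrite /w /threshold_weight.
    by case: ifP => H; case: ifP => //; lia.
  apply: leq_trans (card_crossing lt12 _ _); rewrite -/q; try by rewrite /q; lia.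
  have le1 : (L <= p.2 - p.1)%N by rewrite leq_subRL // ltnW.
  have le2 : (n <= 8 * (q - 5))%N by rewrite /q; lia.
  apply: leq_trans (leq_mul le1 (leqnn _)).
  have -> : (L * (q - 5) = 16 * (8 * (q - 5)) * l)%N by rewrite /L; move: (q - 5)%N => x; lia.
  by rewrite leq_mul2r leq_mul2l le2 !orbT.
have bm : bpm m m./2 ^+ 2 <= 16 / n%:R ^+ 2.
  have n0 : 0 < n%:R ^+ 2 :> rat by rewrite exprn_gt0 // ltr0n; lia.
  rewrite ler_pdivlMr //; apply: le_trans (_ : bpm m m./2 ^+ 2 * (16 * m%:R) <= _).
    apply: ler_wpM2l; first exact: sqr_ge0.
    rewrite -natrX -natrM ler_nat /m.
    have := two_mul_bin2 (n - 3); have := odd_double_half 'C(n - 3, 2).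
    have : (n ^ 2 + 16 <= 4 * ((n - 3) * (n - 3).-1))%N.
      have -> : n = (n - 200 + 200)%N by lia.
      by move: (n - 200)%N => x; rewrite -mulnn; nia.
    by move: ('C(n - 3, 2)) (_./2) ((n - 3) * _)%N (n ^ 2)%N => *; lia.
  by rewrite mulrCA -[leRHS]mulr1 ler_wpM2l // bpm_half_sqr.
have le_close p : p \in close ->
   mean (edges n 3) (fun E => (all (fun v => eqc E v p.1.1) [:: p.1.2; p.2])%:R) <= 16 / n%:R ^+ 2.
  rewrite inE => /and3P[U _ _]; apply: le_trans bm.
  have le_m : (2 * m <= 'C(n - 3, 2))%N by have := odd_double_half 'C(n - 3, 2); lia.
  exact: (@prob_equal_colors_edges n 3 w _ [:: _; _] m isT w12 U le_m).
have card_close : (#|close| <= n * (769 * u) ^ 2)%N.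
  (* A close triple is coded by its first vertex and the displacements of the two others, shifted by
     L to be nonnegative. There are 2 L + 1 = 768 u + 1 <= 769 u possible codes for each. *)
  pose f (p : 'I_n * 'I_n * 'I_n) : 'I_n * ('I_(2 * L).+1 * 'I_(2 * L).+1) :=
    (p.1.1, (inord (p.1.2 + L - p.1.1), inord (p.2 + L - p.1.1))).
  have inj_f : {in close &, injective f}.
    move=> [[x1 y1] z1] [[x2 y2] z2]; rewrite !inE /near /f /=.
    move=> /and3P[_ /andP[? ?] /andP[? ?]] /and3P[_ /andP[? ?] /andP[? ?]] [Ex].
    move=> /(congr1 val) + /(congr1 val); rewrite /= !inordK; try lia.
    have {}Ex : (x1 = x2 :> nat)%N by rewrite Ex.
    by move=> Ey Ez; congr (_, _, _); apply/val_inj => /=; lia.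
  rewrite -(card_in_imset inj_f); apply: leq_trans (max_card _) _.
  rewrite !card_prod !card_ord -mulnn leq_mul2l; apply/orP; right.
  by apply: leq_mul; rewrite /L /l; lia.
apply: (@le_trans _ _ (k%:R * (n%:R ^+ 2 * (2 * 2 ^- l) + #|close|%:R * (16 / n%:R ^+ 2)))).
  rewrite ler_wpM2l ?ler0n //; apply: le_trans (mean_le le_mono) _.
  rewrite meanD !mean_sum lerD //; last first.
    by rewrite mulr_natl -sumr_const; apply: ler_sum.
  apply: (@le_trans _ _ (\sum_(p in far) 2 * 2 ^- l)); first by apply: ler_sum.
  rewrite sumr_const -[X in X <= _]mulr_natl.
  rewrite ler_wpM2r ?mulr_ge0 ?invr_ge0 ?exprn_ge0 // -natrX ler_nat.
  by apply: leq_trans (max_card _) _; rewrite card_prod !card_ord mulnn.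
have n0 : 0 < n%:R :> rat by rewrite ltr0n; lia.
have le1 : k%:R * (n%:R ^+ 2 * (2 * 2 ^- l)) <= 2^-1 :> rat.
  have p0 : 0 < 2 ^+ l :> rat by rewrite exprn_gt0.
  have -> : k%:R * (n%:R ^+ 2 * (2 * 2 ^- l)) = k%:R * n%:R ^+ 2 * 2 / 2 ^+ l :> rat by ring.
  rewrite ler_pdivrMr //; apply: le_trans (_ : 2^-1 * n%:R ^+ 3 <= _); last first.
    rewrite ler_wpM2l ?invr_ge0 // -!natrX ler_nat /l mulnC expnM leq_exp2r //.
    exact: ltnW.
  have k4 : 4 * k%:R <= n%:R :> rat by rewrite -natrM ler_nat; lia.
  have n2 : 0 <= n%:R ^+ 2 :> rat by rewrite sqr_ge0.
  by rewrite (exprS _ 2); move: (n%:R ^+ 2) n2 => N2 n2; nra.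
have le2 : k%:R * (#|close|%:R * (16 / n%:R ^+ 2)) <= 2^-1 :> rat.
  rewrite !mulrA ler_pdivrMr ?exprn_gt0 //.
  have : (2 * (k * #|close| * 16) <= n ^ 2)%N.
    apply: leq_trans (_ : n * (32 * k * (769 * u) ^ 2) <= _)%N.
      apply: leq_trans (_ : 32 * k * (n * (769 * u) ^ 2) <= _)%N; last by rewrite mulnCA.
      by apply: leq_trans (leq_mul (leqnn _) card_close); lia.
    by rewrite -mulnn leq_mul2l le_u orbT.
  by rewrite -(ler_nat rat) natrX !natrM; lra.
by rewrite mulrDr; lra.
Qed.

(** * One weight for r = 3: coincidence of three degrees *)

Lemma sum_addn_eq_le1 m a c : \sum_(y < m) (a == (c + y)%N)%:R <= 1 :> rat.
Proof.
case: (pickP (fun y : 'I_m => a == (c + y)%N)) => [y /eqP Ey|none].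
  rewrite (bigD1 y) //= Ey eqxx big1 ?addr0 // => z neq_zy.
  by rewrite eqn_add2l eq_sym -[_ == _ :> nat]/(z == y) (negPf neq_zy).
by rewrite big1 // => y _; rewrite none.
Qed.

(** Offsets spoil the exact value of [sum_bpm_diag], but not the upper bound. AM-GM replaces the
    product by the mean of three cubes; in each resulting sum the variable in the cube determines
    the other two. Uniformity in the offsets is what permits conditioning on all other edges. *)
Lemma sum_bpm_match_le m a1 a2 a3 :
  \sum_(x < m.+1) \sum_(y < m.+1) \sum_(z < m.+1) bpm m x * bpm m y * bpm m z *
    ((a1 + x == a2 + y)%N && (a1 + x == a3 + z)%N)%:R <= cube_sum m.
Proof.
have split_le c1 c2 c3 : \sum_(x < m.+1) \sum_(y < m.+1) \sum_(z < m.+1) bpm m x ^+ 3 *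
    ((c1 + x == c2 + y)%N && (c1 + x == c3 + z)%N)%:R <= cube_sum m.
  apply: ler_sum => x _.
  under eq_bigr do rewrite -mulr_sumr.
  rewrite -mulr_sumr -[leRHS]mulr1; apply: ler_wpM2l; first by rewrite exprn_ge0 ?bpm_ge0.
  under eq_bigr => y _ do under eq_bigr => z _ do rewrite -mulnb natrM.
  under eq_bigr do rewrite -mulr_sumr.
  rewrite -mulr_suml -[leRHS]mulr1; apply: ler_pM; rewrite ?sum_addn_eq_le1 //.
    by apply: sumr_ge0 => y _; rewrite ler0n.
  by apply: sumr_ge0 => y _; rewrite ler0n.
pose S (i : 'I_3) := \sum_(x < m.+1) \sum_(y < m.+1) \sum_(z < m.+1)
  bpm m (if i == 0 :> nat then x else if i == 1%N :> nat then y else z) ^+ 3 *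
    ((a1 + x == a2 + y)%N && (a1 + x == a3 + z)%N)%:R.
have S0 : S ord0 <= cube_sum m by exact: split_le.
have S1 : S (inord 1) <= cube_sum m.
  apply: le_trans (split_le a2 a1 a3); rewrite /S inordK //= exchange_big /= le_eqVlt.
  apply/orP; left; apply/eqP; apply: eq_bigr => y _; apply: eq_bigr => x _; apply: eq_bigr => z _.
  rewrite (eq_sym (a2 + y)%N (a1 + x)%N); by case: eqP => //= ->.
have S2 : S (inord 2) <= cube_sum m.
  apply: le_trans (split_le a3 a1 a2); rewrite /S inordK //= le_eqVlt; apply/orP; left; apply/eqP.
  rewrite [RHS]exchange_big /=; apply: eq_bigr => x _.
  rewrite [RHS]exchange_big /=; apply: eq_bigr => y _; apply: eq_bigr => z _.
  rewrite (eq_sym (a3 + z)%N (a1 + x)%N) andbC; by case: eqP => //= ->.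
apply: le_trans (_ : (S ord0 + S (inord 1) + S (inord 2)) / 3 <= _); last first.
  by rewrite ler_pdivrMr //; lra.
rewrite /S !inordK //= -!big_split /= mulr_suml; apply: ler_sum => x _.
rewrite -!big_split /= mulr_suml; apply: ler_sum => y _.
rewrite -!big_split /= mulr_suml; apply: ler_sum => z _.
case: (_ && _); rewrite ?mulr0 ?addr0 ?mul0r // !mulr1.
move: (bpm_ge0 m x) (bpm_ge0 m y) (bpm_ge0 m z); move: (bpm m x) (bpm m y) (bpm m z) => a b c a0 b0 c0.
rewrite ler_pdivlMr // -subr_ge0.
have -> : a ^+ 3 + b ^+ 3 + c ^+ 3 - a * b * c * 3 =
  (a + b + c) * ((a - b) ^+ 2 + (b - c) ^+ 2 + (a - c) ^+ 2) / 2 by field.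
by rewrite divr_ge0 // mulr_ge0 ?addr_ge0 ?sqr_ge0.
Qed.

Lemma prob_three_equal (T : finType) (K R1 R2 R3 : {set T}) m (Q : pred {set T}) (a1 a2 a3 : {set T}
  -> nat) :
  R1 \subset K -> R2 \subset K -> R3 \subset K ->
  [disjoint R1 & R2] -> [disjoint R1 & R3] -> [disjoint R2 & R3] ->
  #|R1| = m -> #|R2| = m -> #|R3| = m ->
  mean K (fun E => (Q (E :\: (R1 :|: R2 :|: R3)) && ((a1 (E :\: (R1 :|: R2 :|: R3)) + #|E :&: R1| ==
    a2 (E :\: (R1 :|: R2 :|: R3)) + #|E :&: R2|)%N &&
     (a1 (E :\: (R1 :|: R2 :|: R3)) + #|E :&: R1| == a3 (E :\: (R1 :|: R2 :|: R3)) + #|E :&: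
       R3|)%N))%:R) <=
  cube_sum m * mean K (fun E => (Q (E :\: (R1 :|: R2 :|: R3)))%:R).
Proof.
move=> s1 s2 s3 d12 d13 d23 c1 c2 c3; pose D E := E :\: (R1 :|: R2 :|: R3).
rewrite (mean_cond3 (fun A x y z => (Q A && ((a1 A + x == a2 A + y)%N && (a1 A + x == a3 A +
  z)%N))%:R)) //.
rewrite c1 c2 c3 -meanZ; apply: mean_le => E _; rewrite -/(D E); case: (Q (D E)) => /=; first by
  rewrite mulr1; exact: sum_bpm_match_le.
by rewrite mulr0 big1 // => x _; rewrite big1 // => y _; rewrite big1 // => z _; rewrite mulr0.
Qed.

Lemma sum_bpm_diag m : \sum_(x < m.+1) \sum_(y < m.+1) \sum_(z < m.+1)
  bpm m x * bpm m y * bpm m z * ((x == y :> nat) && (x == z :> nat))%:R = cube_sum m.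
Proof.
apply: eq_bigr => x _; rewrite (bigD1 x) //= [X in _ + X = _]big1 => [|y neq_yx]; last first.
  by rewrite big1 // => z _; rewrite eq_sym [y == x :> nat](negPf neq_yx) mulr0.
rewrite addr0 (bigD1 x) //= [X in _ + X = _]big1 => [|z neq_zx].
  by rewrite !eqxx /= mulr1; ring.
by rewrite eqxx eq_sym [z == x :> nat](negPf neq_zx) mulr0.
Qed.

Section Triple.
Variables (n : nat) (x y z : 'I_n).
Hypothesis Uxyz : uniq [:: x; y; z].

Definition trace_class (a b c : bool) : {set {set 'I_n}} :=
  [set e in edges n 3 | [&& (x \in e) == a, (y \in e) == b & (z \in e) == c]].

Lemma trace_class_sub a b c : trace_class a b c \subset edges n 3.
Proof. by apply/subsetP => e; rewrite inE => /andP[]. Qed.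

Lemma trace_class_disjoint a b c a' b' c' : (a, b, c) != (a', b', c') ->
  [disjoint trace_class a b c & trace_class a' b' c'].
Proof.
move=> neq; rewrite -setI_eq0; apply/eqP/setP => e; rewrite !inE; apply: contraNF neq.
by move=> /andP[/and4P[_ /eqP<- /eqP<- /eqP<-] /and4P[_ /eqP<- /eqP<- /eqP<-]].
Qed.

Lemma card_trace_class a b c :
  #|trace_class a b c| = 'C(n - 3, 3 - (a + b + c)).
Proof.
have [nxy nxz nyz] : [/\ x != y, x != z & y != z].
  by move: Uxyz; rewrite /= !inE negb_or andbT => /andP[/andP[-> ->] ->].
pose A := [set v in [:: x; y; z] | (v == x) && a || (v == y) && b || (v == z) && c].
have sA : A \subset [set v in [:: x; y; z]] by apply/subsetP => v; rewrite !inE => /andP[].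
have cA : #|A| = (a + b + c)%N.
  have -> : A = (if a then [set x] else set0) :|: (if b then [set y] else set0) :|: (if c then [set
    z] else set0).
    apply/setP => v; rewrite !inE; case: (a); case: (b); case: (c); rewrite ?inE ?andbT ?andbF ?orbF //;
    by case: (v == x); case: (v == y); case: (v == z).
  by case: (a); case: (b); case: (c); rewrite ?setU0 ?set0U ?cards0 ?cards1 // ?cardsU1 -?setUA
    ?cardsU1 ?inE ?negb_or ?cards1 ?nxy ?nxz ?nyz.
have := @card_trace _ [set v in [:: x; y; z]] A 3 sA; rewrite cA card_ord.
have -> : #|[set v in [:: x; y; z]]| = 3 by rewrite cardsE (card_uniqP Uxyz).
move=> <-; last by case: (a); case: (b); case: (c).
apply: eq_card => e; rewrite !inE; congr (_ && _); apply/and3P/eqP => [[/eqP ea /eqP eb /eqP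
  ec]|/setP H].
  apply/setP => v; rewrite !inE.
  case: (eqVneq v x) => [->|vx]; first by rewrite ea (negPf nxy) (negPf nxz) /= !andbT !orbF.
  case: (eqVneq v y) => [->|vy]; first by rewrite eb (negPf nyz) /= !andbT !orbF.
  by case: (eqVneq v z) => [->|vz]; [rewrite ec /= andbT | rewrite andbF].
have := H x; have := H y; have := H z; rewrite !inE !eqxx.
rewrite ![y == x]eq_sym ![z == _]eq_sym (negPf nxy) (negPf nxz) (negPf nyz) /= ?orbT ?andbT ?orbF.
by move=> -> -> ->; rewrite !eqxx.
Qed.
End Triple.

Definition degree n (E : {set {set 'I_n}}) (v : 'I_n) : nat := color (fun=> 1%N) E v.

Lemma degreeE n (E : {set {set 'I_n}}) v : degree E v = #|[set e in E | v \in e]|.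
Proof. by rewrite /degree /color sum1dep_card. Qed.

Section FirstMoment.
Variables (n : nat) (x y z : 'I_n).
Hypothesis Uxyz : uniq [:: x; y; z].
Let K : {set {set 'I_n}} := edges n 3.
Let cl := trace_class x y z.

Lemma degree_trace_class (E : {set {set 'I_n}}) : E \subset K ->
  [/\ degree E x = (#|E :&: cl true true true| + #|E :&: cl true true false|
        + #|E :&: cl true false true| + #|E :&: cl true false false|)%N,
      degree E y = (#|E :&: cl true true true| + #|E :&: cl true true false|
        + #|E :&: cl false true true| + #|E :&: cl false true false|)%N &
      degree E z = (#|E :&: cl true true true| + #|E :&: cl true false true|
        + #|E :&: cl false true true| + #|E :&: cl false false true|)%N].
Proof.
move=> sE.
have split2 (F : {set {set 'I_n}}) (u v : 'I_n) : #|F| =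
    (#|F :&: [set e : {set 'I_n} | (u \in e) && (v \in e)]| + #|F :&: [set e : {set 'I_n} | (u \in
      e) && (v \notin e)]|
   + #|F :&: [set e : {set 'I_n} | (u \notin e) && (v \in e)]| + #|F :&: [set e : {set 'I_n} | (u
     \notin e) && (v \notin e)]|)%N.
  rewrite -(cardsID [set e : {set 'I_n} | u \in e] F).
  rewrite -(cardsID [set e : {set 'I_n} | v \in e] (F :&: _)) -(cardsID [set e : {set 'I_n} | v \in
    e] (F :\: _)).
  rewrite !addnA; congr (_ + _ + _ + _)%N; apply: eq_card => e; rewrite !inE;
  by case: (e \in F); case: (u \in e); case: (v \in e).
have Kcl e : e \in E -> #|e| == 3 by move/(subsetP sE); rewrite inE.
split; rewrite degreeE; [rewrite (split2 _ y z) | rewrite (split2 _ x z) | rewrite (split2 _ x y)];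
  congr (_ + _ + _ + _)%N; apply: eq_card => e; rewrite !inE;
  case: (boolP (e \in E)) => //= /Kcl->;
  by case: (x \in e); case: (y \in e); case: (z \in e).
Qed.

Lemma card_setI_symdiff (T : finType) (E D R : {set T}) : R \subset D ->
  #|((E :\: D) :|: (D :\: E)) :&: R| = (#|R| - #|E :&: R|)%N.
Proof.
move=> sRD; rewrite (setIC E) -cardsD; apply: eq_card => t; rewrite !inE.
by case: (boolP (t \in R)) => [/(subsetP sRD)->|]; rewrite ?andbF ?andbT //; case: (t \in E).
Qed.

Lemma setI_symdiff_disjoint (T : finType) (E D R : {set T}) : [disjoint R & D] ->
  ((E :\: D) :|: (D :\: E)) :&: R = E :&: R.
Proof.
move=> dRD; apply/setP => t; rewrite !inE.
case: (boolP (t \in R)) => [Rt|]; rewrite ?andbF ?andbT //.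
by rewrite (disjointFr dRD Rt) andbF orbF.
Qed.

(* Complementing E on the edges that meet {x, y, z} in two points turns equality of the three degrees
   into equality of three independent binomials with the same parameter 'C(n - 2, 2). *)
Lemma prob_triple_equal :
  mean K (fun E => ((degree E x == degree E y) && (degree E x == degree E z))%:R) =
  cube_sum 'C(n - 2, 2).
Proof.
have n3 : (3 <= n)%N.
  by have := max_card (mem [:: x; y; z]); rewrite (card_uniqP Uxyz) card_ord.
have En : (n - 2 = (n - 3).+1)%N by clear -n3; lia.
pose D := cl true true false :|: cl true false true :|: cl false true true.
have sDK : D \subset K by rewrite !subUset !trace_class_sub.
(* After complementing on D, the degree of x is a common constant minus the classes xy and xz plus
   the class x. Adding all three classes of D to each degree leaves class x plus class yz for x, and
   likewise for y and z. These unions are disjoint, of size C(n-3, 2) + (n-3) = C(n-2, 2). *)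
pose R1 := cl true false false :|: cl false true true.
pose R2 := cl false true false :|: cl true false true.
pose R3 := cl false false true :|: cl true true false.
have cI (E : {set {set 'I_n}}) a b c a' b' c' : (a, b, c) != (a', b', c') ->
    #|E :&: (cl a b c :|: cl a' b' c')| = (#|E :&: cl a b c| + #|E :&: cl a' b' c'|)%N.
  move=> neq; rewrite setIUr cardsU.
  have -> : (E :&: cl a b c) :&: (E :&: cl a' b' c') = set0; last by rewrite cards0 subn0.
  apply/eqP; rewrite setI_eq0; apply: disjointW (trace_class_disjoint x y z neq); exact: subsetIr.
have cR (R : {set {set 'I_n}}) a b c a' b' c' : R = cl a b c :|: cl a' b' c' ->
    (a + b + c = 1)%N -> (a' + b' + c' = 2)%N -> #|R| = 'C(n - 2, 2).
  move=> -> s1 s2; have neq : (a, b, c) != (a', b', c').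
    by apply/eqP => -[Ea Eb Ec]; move: s2; rewrite -Ea -Eb -Ec s1.
  have := cI K _ _ _ _ _ _ neq.
  have sK : cl a b c :|: cl a' b' c' \subset K by rewrite subUset !trace_class_sub.
  rewrite (setIidPr sK) !(setIidPr (trace_class_sub _ _ _ _ _ _)) => ->.
  rewrite !card_trace_class // s1 s2 !subSS !subn0.
  by rewrite En.
have c1 := cR R1 _ _ _ _ _ _ erefl erefl erefl.
have c2 := cR R2 _ _ _ _ _ _ erefl erefl erefl.
have c3 := cR R3 _ _ _ _ _ _ erefl erefl erefl.
have dcl a b c a' b' c' : (a, b, c) != (a', b', c') -> [disjoint cl a b c & cl a' b' c'].
  exact: trace_class_disjoint.
have disjU (A B C' D' : {set {set 'I_n}}) : [disjoint A & C'] -> [disjoint A & D'] ->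
    [disjoint B & C'] -> [disjoint B & D'] -> [disjoint A :|: B & C' :|: D'].
  by rewrite -!setI_eq0 setIUl !setIUr => /eqP-> /eqP-> /eqP-> /eqP->; rewrite !setU0.
rewrite (mean_symdiff _ sDK).
rewrite (mean_eq (g := fun E => ((#|E :&: R1| == #|E :&: R2| :> nat) && (#|E :&: R1| == #|E :&: R3|
  :> nat))%:R)).
  rewrite (mean_cond3 (fun _ a b c => ((a == b) && (a == c))%:R)); last first.
  - by apply: disjU; apply: dcl.
  - by apply: disjU; apply: dcl.
  - by apply: disjU; apply: dcl.
  - by rewrite subUset !trace_class_sub.
  - by rewrite subUset !trace_class_sub.
  - by rewrite subUset !trace_class_sub.
  by rewrite mean_cst c1 c2 c3 sum_bpm_diag.
move=> E sE; set E' := _ :|: _.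
have sE' : E' \subset K by rewrite subUset !(subset_trans (subsetDl _ _)).
have [-> -> ->] := degree_trace_class sE'.
have keep (a b c : bool) : (a + b + c != 2)%N -> E' :&: cl a b c = E :&: cl a b c.
  move=> ne2; apply: setI_symdiff_disjoint; rewrite disjoint_sym.
  rewrite -setI_eq0 !setIUl !setU_eq0 !setI_eq0 -andbA; apply/and3P.
  by split; apply: dcl; apply: contraNneq ne2 => -[<- <- <-].
rewrite (keep true true true) // (keep true false false) // (keep false true false) //
  (keep false false true) //.
have sD1 : cl true true false \subset D by rewrite /D -setUA subsetUl.
have sD2 : cl true false true \subset D by rewrite /D setUAC subsetUr.
have sD3 : cl false true true \subset D by rewrite subsetUr.
rewrite /E' !card_setI_symdiff // /R1 /R2 /R3 !cI // !card_trace_class //.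
have leC (a b c : bool) : (#|E :&: cl a b c| <= 'C(n - 3, 3 - (a + b + c)))%N.
  by rewrite -(card_trace_class Uxyz) subset_leq_card // subsetIr.
have := leC true true false; have := leC true false true; have := leC false true true.
rewrite /=; set N := 'C(_, _); move=> l1 l2 l3.
by congr (nat_of_bool _)%:R; congr (_ && _); apply/eqP/eqP; clear -l1 l2 l3; lia.
Qed.
End FirstMoment.

(** * One weight for r = 3: pairs of disjoint triples *)

Definition private_edges n (S : {set 'I_n}) v : {set {set 'I_n}} :=
  [set e in edges n 3 | e :&: S == [set v]].

Lemma private_edges_sub n (S : {set 'I_n}) v : private_edges S v \subset edges n 3.
Proof. by apply/subsetP => e; rewrite inE => /andP[]. Qed.

Lemma mem_private_edges n (S : {set 'I_n}) u v e :
  u \in S -> e \in private_edges S v -> (u \in e) = (u == v).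
Proof. by move=> Su; rewrite inE => /andP[_ /eqP/setP/(_ u)]; rewrite !inE Su andbT. Qed.

Lemma card_private_edges n (S : {set 'I_n}) v : v \in S ->
  #|private_edges S v| = 'C(n - #|S|, 2).
Proof.
move=> Sv; have := @card_trace _ S [set v] 3; rewrite sub1set cards1 card_ord => <- //.
by apply: eq_card => e; rewrite !inE.
Qed.

Definition equal_degrees n (E : {set {set 'I_n}}) (x y z : 'I_n) :=
  (degree E x == degree E y) && (degree E x == degree E z).

(** Q is any event not affected by the private edges of x, y, z. It may thus contain the equality of
    degrees on another triple of S, which allows the bound to be applied twice. *)
Lemma prob_equal_degrees_and n (S : {set 'I_n}) x y z (Q : pred {set {set 'I_n}}) :
  uniq [:: x; y; z] -> x \in S -> y \in S -> z \in S ->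
  (forall E u, u \in [:: x; y; z] -> Q (E :\: private_edges S u) = Q E) ->
  mean (edges n 3) (fun E => (Q E && equal_degrees E x y z)%:R) <=
  cube_sum 'C(n - #|S|, 2) * mean (edges n 3) (fun E => (Q E)%:R).
Proof.
move=> U Sx Sy Sz QP; pose P := private_edges S.
have [nxy nxz nyz] : [/\ x != y, x != z & y != z].
  by move: U; rewrite /= !inE negb_or andbT => /andP[/andP[-> ->] ->].
have dP u v : u \in S -> u != v -> [disjoint P u & P v].
  move=> Su neq; rewrite -setI_eq0; apply/eqP/setP => e; rewrite in_setI in_set0.
  apply/negP => /andP[eu ev]; have := mem_private_edges Su ev.
  by rewrite (mem_private_edges Su eu) eqxx (negPf neq).
pose D (E : {set {set 'I_n}}) := E :\: (P x :|: P y :|: P z).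
have QD E : Q (D E) = Q E.
  by rewrite /D -!setDDl !QP // !inE eqxx ?orbT.
have degD u v (E : {set {set 'I_n}}) : u \in S -> u != v -> degree (E :\: P v) u = degree E u.
  move=> Su neq; apply: color_setD => e ev; by rewrite (mem_private_edges Su ev).
have degP u (E : {set {set 'I_n}}) : u \in S -> degree E u = (degree (E :\: P u) u + #|E :&: P u|)%N.
  move=> Su; rewrite /degree (@color_split _ _ 1 E (P u)) ?mul1n // => e eu.
  by rewrite (mem_private_edges Su eu) !eqxx.
have dx E : degree E x = (degree (D E) x + #|E :&: P x|)%N.
  by rewrite /D -!setDDl (degD x z) // (degD x y) // -degP.
have dy E : degree E y = (degree (D E) y + #|E :&: P y|)%N.
  by rewrite /D (setUC (P x)) -!setDDl (degD y z) // (degD y x) // 1?eq_sym // -degP.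
have dz E : degree E z = (degree (D E) z + #|E :&: P z|)%N.
  by rewrite /D setUC -!setDDl (degD z y) // 1?eq_sym // (degD z x) // 1?eq_sym // -degP.
rewrite (mean_eq (g := fun E => (Q (D E) && ((degree (D E) x + #|E :&: P x| == degree (D E) y + #|E
  :&: P y|)%N &&
   (degree (D E) x + #|E :&: P x| == degree (D E) z + #|E :&: P z|)%N))%:R)); last first.
  by move=> E _; rewrite -dx -dy -dz QD.
have sub := private_edges_sub S; have crd := @card_private_edges n S.
have := prob_three_equal Q ((@degree n)^~ x) ((@degree n)^~ y) ((@degree n)^~ z)
  (sub x) (sub y) (sub z) (dP _ _ Sx nxy) (dP _ _ Sx nxz) (dP _ _ Sy nyz)
  (crd _ Sx) (crd _ Sy) (crd _ Sz).
move=> le; apply: le_trans le _.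
rewrite ler_wpM2l ?cube_sum_ge0 //; apply: mean_le => E _; by rewrite -/(D E) QD.
Qed.

Lemma prob_two_edges n (t t' : {set 'I_n}) :
  t \in edges n 3 -> t' \in edges n 3 -> t != t' ->
  mean (edges n 3) (fun E => ((t \in E) && (t' \in E))%:R) = 4^-1.
Proof.
move=> Kt Kt' neq.
rewrite (mean_eq (g := fun E => (t \in E)%:R * (t' \in E)%:R)); last by move=> E _; rewrite -mulnb natrM.
rewrite mean_mem //; last by move=> E; rewrite !inE eq_sym neq.
rewrite (mean_eq (g := fun E => (t' \in E)%:R * 1)); last by move=> E _; rewrite mulr1.
by rewrite mean_mem // mean_cst; field.
Qed.

(** S consists of all six vertices. The two triples lie inside S and meet it in three points, so
    they are private to nobody, and their presence, of probability 1/4, remains part of the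
    conditioning. *)
Lemma prob_disjoint_triples n (x y z x' y' z' : 'I_n) :
  uniq [:: x; y; z; x'; y'; z'] ->
  mean (edges n 3) (fun E => ((([set x; y; z] \in E) && ([set x'; y'; z'] \in E)) &&
     equal_degrees E x' y' z' && equal_degrees E x y z)%:R) <=
  cube_sum 'C(n - 6, 2) ^+ 2 / 4.
Proof.
move=> U6; set t := [set x; y; z]; set t' := [set x'; y'; z'].
pose s := [:: x; y; z; x'; y'; z']; pose S := [set v in s].
have cS : #|S| = 6 by rewrite cardsE (card_uniqP U6).
have U6' : uniq ([:: x; y; z] ++ [:: x'; y'; z']) := U6.
have [U disj U'] : [/\ uniq [:: x; y; z], ~~ has (mem [:: x; y; z]) [:: x'; y'; z'] & uniq [:: x';
  y'; z']].
  by apply/and3P; rewrite -cat_uniq.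
have ct a b c : uniq [:: a; b; c] -> #|[set a; b; c] : {set 'I_n}| = 3.
  move=> Uabc; transitivity #|[set v in [:: a; b; c]]|; last by rewrite cardsE (card_uniqP Uabc).
  by apply: eq_card => v; rewrite !inE orbA.
have st : t \subset S by apply/subsetP => v; rewrite !inE => /orP[/orP[]|] ->; rewrite ?orbT.
have st' : t' \subset S by apply/subsetP => v; rewrite !inE => /orP[/orP[]|] ->; rewrite ?orbT.
have Kt : t \in edges n 3 by rewrite inE ct.
have Kt' : t' \in edges n 3 by rewrite inE ct.
have notP T v : T \in edges n 3 -> T \subset S -> T \notin private_edges S v.
  rewrite inE => /eqP cT sT; rewrite inE (setIidPl sT) negb_and; apply/orP; right.
  by apply: contra_eqN (cT) => /eqP->; rewrite cards1.
have neq : t != t'.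
  apply: contraTneq U6 => Ett; have : x \in t' by rewrite -Ett !inE eqxx.
  by rewrite /= !inE => /orP[/orP[]|] ->; rewrite ?orbT.
pose Q0 (E : {set {set 'I_n}}) := (t \in E) && (t' \in E).
have Q0P E v : Q0 (E :\: private_edges S v) = Q0 E.
  by rewrite /Q0 !in_setD !notP.
have Ss v : v \in s -> v \in S by rewrite in_set.
have le1 := @prob_equal_degrees_and n S x' y' z' Q0 U' (Ss _ _) (Ss _ _) (Ss _ _) (fun E u _ => Q0P E u).
have le2 := @prob_equal_degrees_and n S x y z (fun E => Q0 E && equal_degrees E x' y' z') U (Ss _ _)
  (Ss _ _) (Ss _ _) _.
rewrite cS in le1 le2.
apply: le_trans (le2 _ _ _ _) _; rewrite ?inE ?eqxx ?orbT //.
  move=> E u ux; rewrite Q0P; congr (_ && _); rewrite /equal_degrees.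
  have deg v : v \in [:: x'; y'; z'] -> degree (E :\: private_edges S u) v = degree E v.
    move=> vx'; apply: color_setD => e eu; rewrite (mem_private_edges _ eu).
      by apply: contraNneq disj => Evu; apply/hasP; exists v => //=; rewrite Evu.
    by rewrite in_set; have : v \in [:: x; y; z] ++ [:: x'; y'; z'] by rewrite mem_cat vx' orbT.
  by rewrite !deg // !inE eqxx ?orbT.
apply: le_trans (ler_wpM2l (cube_sum_ge0 _) (le1 _ _ _)) _; rewrite ?inE ?eqxx ?orbT //.
by rewrite prob_two_edges // mulrA expr2.
Qed.

(** * One weight for r = 3: the second moment *)

Definition mono_edge n (E : {set {set 'I_n}}) (t : {set 'I_n}) : bool :=
  (t \in E) && monochromatic E [ffun=> ord0 : 'I_1] t.

Lemma degree_induced n (E : {set {set 'I_n}}) v :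
  induced_color E [ffun=> ord0 : 'I_1] v = degree E v.
Proof. by apply: eq_bigr => e _; rewrite ffunE. Qed.

Lemma monochromaticP n (E : {set {set 'I_n}}) (t : {set 'I_n}) :
  reflect {in t &, forall u v, degree E u = degree E v} (monochromatic E [ffun=> ord0 : 'I_1] t).
Proof.
apply: (iffP forall_inP) => [me u v tu tv|me u tu].
  by have /forall_inP/(_ v tv)/eqP := me u tu; rewrite !degree_induced.
by apply/forall_inP => v tv; rewrite !degree_induced (me u v).
Qed.

Lemma mono_edge_triple n (E : {set {set 'I_n}}) x y z :
  mono_edge E [set x; y; z] = ([set x; y; z] \in E) && equal_degrees E x y z.
Proof.
congr (_ && _); apply/monochromaticP/andP => [me|[/eqP xy /eqP xz] u v].
  by split; apply/eqP/me; rewrite !inE eqxx ?orbT.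
by rewrite !inE -!orbA => /or3P[] /eqP-> /or3P[] /eqP->; rewrite -?xy -?xz.
Qed.

(** Deleting t shifts the degrees of its three vertices by the same amount, so the presence of t is
    independent of their being equal. *)
Lemma mean_mono_edge n (t : {set 'I_n}) : t \in edges n 3 ->
  mean (edges n 3) (fun E => (mono_edge E t)%:R) = cube_sum 'C(n - 2, 2) / 2.
Proof.
move=> Kt; have [x [y [z [U Et]]]] := edges3P Kt.
transitivity (mean (edges n 3) (fun E => (t \in E)%:R * (equal_degrees E x y z)%:R)).
  by apply: mean_eq => E _; rewrite Et mono_edge_triple -mulnb natrM.
rewrite mean_mem //; first by congr (_ / 2); exact: prob_triple_equal.
move=> E; congr (nat_of_bool _)%:R.
have deg v : v \in t -> (degree (E :\ t) v + (t \in E))%N = degree E v.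
  move=> tv; rewrite /degree (@color_split _ _ 1 E [set t]) ?mul1n.
    congr (_ + _)%N; case: (boolP (t \in E)) => tE.
      by rewrite (setIidPr _) ?cards1 // sub1set.
    by apply/esym/eqP; rewrite cards_eq0 setI_eq0 disjoint_sym disjoints1.
  by move=> e; rewrite inE => /eqP->; rewrite tv eqxx.
have [tx ty tz] : [/\ x \in t, y \in t & z \in t] by rewrite Et !inE !eqxx !orbT.
by rewrite /equal_degrees -(deg x) // -(deg y) // -(deg z) // !eqn_add2r.
Qed.

Lemma mean_mono_edge_disjoint n (t t' : {set 'I_n}) :
  t \in edges n 3 -> t' \in edges n 3 -> t :&: t' = set0 ->
  mean (edges n 3) (fun E => (mono_edge E t && mono_edge E t')%:R) <=
  cube_sum 'C(n - 6, 2) ^+ 2 / 4.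
Proof.
move=> Kt Kt' tt'; have [x [y [z [U Et]]]] := edges3P Kt.
have [x' [y' [z' [U' Et']]]] := edges3P Kt'.
have U6 : uniq ([:: x; y; z] ++ [:: x'; y'; z']).
  rewrite cat_uniq; apply/and3P; split=> //; apply/hasPn => v vt'; apply/negP => vt.
  have : v \in t :&: t' by rewrite Et Et' !inE -!orbA; move: vt vt'; rewrite /= !inE => -> ->.
  by rewrite tt' inE.
apply: le_trans (prob_disjoint_triples U6); apply: mean_le => E _; apply: ler_bool.
rewrite Et Et' !mono_edge_triple => /andP[/andP[-> ->] /andP[-> ->]] //.
Qed.

(** A common vertex v forces one degree on the whole union, which has 6 - |t :&: t'| <= 5 vertices,
    v included. The case t = t' is covered, with exponent 2. *)
Lemma mean_mono_edge_meet n (t t' : {set 'I_n}) m :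
  t \in edges n 3 -> t' \in edges n 3 -> t :&: t' != set0 -> (2 * m <= 'C(n - 5, 2))%N ->
  mean (edges n 3) (fun E => (mono_edge E t && mono_edge E t')%:R) <=
  bpm m m./2 ^+ (5 - #|t :&: t'|).
Proof.
rewrite !inE => /eqP ct /eqP ct' ne0 le_m.
have /set0Pn[v] := ne0; rewrite inE => /andP[tv tv'].
pose l := enum ((t :|: t') :\ v).
have sz : size l = (5 - #|t :&: t'|)%N.
  rewrite -cardE; have := cardsD1 v (t :|: t'); rewrite cardsU ct ct' inE tv /=.
  by rewrite add1n => E; apply/eq_add_S; rewrite -E; move: ne0; rewrite -card_gt0; lia.
rewrite -sz.
have Ul : uniq (v :: l) by rewrite /= enum_uniq mem_enum !inE eqxx.
apply: le_trans (@prob_equal_colors_edges n 3 (fun=> 1%N) v l m isT _ Ul _) => //.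
  apply: mean_le => E _; apply: ler_bool => /andP[/andP[_ /monochromaticP me] /andP[_
    /monochromaticP me']].
  apply/allP => u; rewrite mem_enum !inE => /andP[_ /orP[tu|tu]]; apply/eqP.
    exact: me.
  exact: me'.
apply: leq_trans le_m _; apply: leq_bin2l; rewrite sz.
by move: ne0; rewrite -card_gt0; lia.
Qed.

(** Sorted by the intersection A with t: at most n^(3-|A|) edges, each with probability at most
    (4/n)^(5-|A|), so n^-2 in every case. The worst constant is 4^4 = 256, for |A| = 1, and t has 8
    subsets. *)
Lemma sum_mean_mono_edge_meet n (t : {set 'I_n}) m : (0 < n)%N -> t \in edges n 3 ->
  (2 * m <= 'C(n - 5, 2))%N -> bpm m m./2 <= 4 / n%:R ->
  \sum_(t' in edges n 3 | t :&: t' != set0)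
    mean (edges n 3) (fun E => (mono_edge E t && mono_edge E t')%:R) <= 2048 / n%:R ^+ 2.
Proof.
move=> n0 Kt le_m leb; have N0 : 0 < n%:R :> rat by rewrite ltr0n.
have ct : #|t| = 3 by move: Kt; rewrite inE => /eqP.
rewrite (partition_big (fun t' => t' :&: t) (fun A => A \in powerset t :\ set0)) /=; last first.
  by move=> t' /andP[_ ne0]; rewrite !inE subsetIr setIC ne0.
apply: le_trans (_ : \sum_(A in powerset t :\ set0) (256 / n%:R ^+ 2) <= _).
  apply: ler_sum => A; rewrite !inE => /andP[neA sA].
  have cA : (0 < #|A| <= 3)%N by rewrite card_gt0 neA; have := subset_leq_card sA; rewrite ct.
  apply: le_trans (_ : \sum_(t' in [set e : {set 'I_n} | (#|e| == 3) && (e :&: t == A)])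
      (4 / n%:R) ^+ (5 - #|A|) <= _).
    rewrite [X in X <= _](eq_bigl (mem [set e : {set 'I_n} | (#|e| == 3) && (e :&: t == A)])); last
      first.
      move=> e /=; rewrite !in_set (setIC t) -andbA; congr (_ && _).
      by case: (eqVneq (e :&: t) A) => [->|_]; rewrite ?neA ?andbF.
    apply: ler_sum => e /=; rewrite in_set => /andP[ce /eqP eA].
    have Ke : e \in edges n 3 by rewrite inE.
    have ne0 : t :&: e != set0 by rewrite setIC eA.
    apply: le_trans (mean_mono_edge_meet Kt Ke ne0 le_m) _.
    by rewrite setIC eA; apply: lerXn2r; rewrite ?nnegrE ?bpm_ge0 ?divr_ge0 ?ler0n.
  rewrite sumr_const (card_trace sA); last by case/andP: cA.
  rewrite ct card_ord -[X in X <= _]mulr_natl.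
  apply: le_trans (_ : n%:R ^+ (3 - #|A|) * (4 / n%:R) ^+ (5 - #|A|) <= _).
    apply: ler_wpM2r; first by rewrite exprn_ge0 ?divr_ge0 ?ler0n.
    rewrite -natrX ler_nat; apply: leq_trans (bin_le_exp _ _) _.
    by case: (3 - #|A|)%N => [|s]; rewrite ?expn0 ?leq_exp2r ?leq_subr.
  have nN : n%:R != 0 :> rat by rewrite gt_eqF.
  have n2 : 0 < (n%:R ^+ 2)^-1 :> rat by rewrite invr_gt0 exprn_gt0.
  case: #|A| cA => [|[|[|[|a]]]] cA; try discriminate cA; rewrite ?subSS ?subn0 ?expr0 ?expr1.
  - have -> : n%:R ^+ 2 * (4 / n%:R) ^+ 4 = 256 / n%:R ^+ 2 :> rat by field.
    exact: lexx.
  - have -> : n%:R * (4 / n%:R) ^+ 3 = 64 / n%:R ^+ 2 :> rat by field.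
    by rewrite (ler_pM2r n2) ler_nat.
  - have -> : 1 * (4 / n%:R) ^+ 2 = 16 / n%:R ^+ 2 :> rat by field.
    by rewrite (ler_pM2r n2) ler_nat.
rewrite sumr_const -[X in X <= _]mulr_natl mulrA ler_pM2r; last by rewrite invr_gt0 exprn_gt0.
apply: le_trans (_ : 8 * 256 <= _); last by lra.
rewrite ler_pM2r ?ltr0n // ler_nat.
apply: leq_trans (subset_leq_card (subsetDl _ _)) _; by rewrite card_powerset ct.
Qed.

(** Chebyshev: with X the number of events Y i that occur, X = 0 on Z, hence mu^2 <= (X - mu)^2
    there. *)
Lemma second_moment (T I : finType) (K : {set T}) (A : {set I}) (Y : I -> pred {set T}) (Z : pred
  {set T}) (mu : rat) :
  (forall (E : {set T}) i, E \subset K -> Z E -> i \in A -> ~~ Y i E) ->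
  \sum_(i in A) mean K (fun E => (Y i E)%:R) = mu ->
  mean K (fun E => (Z E)%:R) * mu ^+ 2 <=
  \sum_(i in A) \sum_(j in A) mean K (fun E => (Y i E && Y j E)%:R) - mu ^+ 2.
Proof.
move=> ZY Emu; pose X (E : {set T}) : rat := \sum_(i in A) (Y i E)%:R.
have meanX : mean K X = mu by rewrite /X mean_sum.
have meanXX : mean K (fun E => X E ^+ 2) =
    \sum_(i in A) \sum_(j in A) mean K (fun E => (Y i E && Y j E)%:R).
  under eq_bigr do rewrite -mean_sum.
  rewrite -mean_sum; apply: mean_eq => E _; rewrite expr2 /X big_distrlr /=.
  by apply: eq_bigr => i _; apply: eq_bigr => j _; rewrite -mulnb natrM.
apply: le_trans (_ : mean K (fun E => X E ^+ 2 + ((- 2 * mu) * X E + mu ^+ 2)) <= _).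
  rewrite mulrC -meanZ; apply: mean_le => E sE.
  have -> : X E ^+ 2 + ((- 2 * mu) * X E + mu ^+ 2) = (X E - mu) ^+ 2 by ring.
  case: (boolP (Z E)) => [ZE|_]; last by rewrite mulr0 sqr_ge0.
  have -> : X E = 0 by rewrite /X big1 // => i Ai; rewrite (negPf (ZY E i sE ZE Ai)).
  by rewrite mulr1 sub0r sqrrN.
by rewrite !meanD meanZ mean_cst meanX meanXX; lra.
Qed.

Lemma cube_sum_ratio M j : (0 < M)%N ->
  cube_sum M <= cube_sum (M + j) * (1 + 12 / M%:R) ^+ j.
Proof.
move=> M0; have N0 : 0 < M%:R :> rat by rewrite ltr0n.
elim: j => [|j IH]; first by rewrite addn0 expr0 mulr1.
apply: le_trans IH _; rewrite exprS mulrA addnS; apply: ler_wpM2r.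
  by rewrite exprn_ge0 ?addr_ge0 ?divr_ge0 ?ltW.
apply: le_trans (cube_sum_pred _) _; apply: ler_wpM2l; first exact: cube_sum_ge0.
rewrite lerD2l ler_wpM2l // lef_pV2 ?posrE ?ltr0n // ler_nat -addnS; exact: leq_addr.
Qed.

Lemma not_weakly_weighted1 n (E : {set {set 'I_n}}) (t : {set 'I_n}) :
  weakly_weighted E 1 -> ~~ mono_edge E t.
Proof.
case/existsP => om /forall_inP nomono; apply/negP => /andP[tE].
have <- : om = [ffun=> ord0] by apply/ffunP => e; rewrite ffunE ord1.
by rewrite (negPf (nomono t tE)).
Qed.

Lemma ler_sqr_ge0 (a b : rat) : 0 <= a -> a <= b -> a ^+ 2 <= b ^+ 2.
Proof. by move=> a0 le_ab; rewrite !expr2 ler_pM. Qed.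

(** The variance is divided by the squared mean (c F2/2)^2. Disjoint pairs contribute (F6/F2)^2 - 1
    <= 4 d, where d = 192/n bounds (4 n) * 12 / M with M >= n^2/4. Meeting pairs contribute 4 *
    2048/(c F2^2 n^2), which is O(1/n) because F2 >= 1/(2 n^2) and c >= n^3/(27 * 8). *)
Lemma prob_weakly_weighted1_le n : (800 <= n)%N ->
  mean (edges n 3) (fun E => (weakly_weighted E 1)%:R) <=
  4 * (192 / n%:R) + 2048 * (4 * 4 * 27 * 8) / n%:R.
Proof.
move=> le_n; set K := edges n 3; set p := mean _ _.
have n0 : 0 < n%:R :> rat by rewrite ltr0n; lia.
pose M := 'C(n - 6, 2); pose j := (4 * n - 18)%N; pose m := ('C(n - 5, 2))./2.
have E2 := two_mul_bin2 (n - 2); have E6 := two_mul_bin2 (n - 6); have E5 := two_mul_bin2 (n - 5).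
have En : (n = (n - 800) + 800)%N by clear -le_n; lia.
have EM : 'C(n - 2, 2) = (M + j)%N.
  by rewrite /M /j; move: E2 E6; rewrite En; move: (n - 800)%N => x; clear; nia.
have leM : (n ^ 2 <= 4 * M)%N.
  by rewrite /M -mulnn; move: E6; rewrite En; move: (n - 800)%N => x; clear; nia.
have leM2 : (2 * 'C(n - 2, 2) <= n ^ 2)%N by rewrite E2 -mulnn leq_mul //; clear; lia.
have le_m : (n ^ 2 <= 16 * m)%N.
  rewrite /m -mulnn; move: (odd_double_half 'C(n - 5, 2)) E5.
  by rewrite En; move: (n - 800)%N => x; clear; nia.
have lec : (n ^ 3 <= 27 * 8 * 'C(n, 3))%N.
  apply: leq_trans (_ : 8 * (n - 3) ^ 3 <= _)%N; last first.
    by rewrite (mulnC 27 8) -mulnA leq_mul2l /=; exact: bin_ge_exp.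
  by rewrite -(expnMn 2 _ 3) leq_exp2r //; clear -le_n; lia.
pose F2 := cube_sum 'C(n - 2, 2); pose F6 := cube_sum M; pose c : rat := 'C(n, 3)%:R.
have M0 : (0 < M)%N by apply: contraTT leM; clear -le_n; nia.
have F60 : 0 <= F6 := cube_sum_ge0 _.
have F20 : 1 <= F2 * (2 * n%:R ^+ 2).
  apply: le_trans (@cube_sum_ge 'C(n - 2, 2) _) _; first by rewrite EM ltn_addr.
  apply: ler_wpM2l; first exact: cube_sum_ge0.
  by rewrite -natrX -!natrM ler_nat; clear -leM2; lia.
have F2p : 0 < F2.
  by have := cube_sum_ge0 'C(n - 2, 2); rewrite le_eqVlt => /orP[/eqP E|//]; move: F20; rewrite /F2
    -E mul0r ler10.
pose d : rat := 192 / n%:R.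
have d0 : 0 <= d by apply: divr_ge0; [exact: ler0n | exact: ltW].
have d4 : d <= 4^-1.
  have n800 : 800 <= n%:R :> rat by rewrite ler_nat.
  by rewrite (ler_pdivrMr _ _ n0); clear -n800; lra.
have d1 : 0 <= 1 - d by move: (d) d4 => e e4; clear -e4; lra.
have F6d : F6 * (1 - d) <= F2.
  have M0r : 0 < M%:R :> rat by rewrite ltr0n.
  have x0 : 0 <= 12 / M%:R :> rat by apply: divr_ge0; [exact: ler0n | exact: ltW].
  have jx : j%:R * (12 / M%:R) <= d.
    rewrite mulrA (ler_pdivrMr _ _ M0r) /d mulrAC (ler_pdivlMr _ _ n0).
    have le_j : j%:R <= 4 * n%:R :> rat by rewrite -natrM ler_nat leq_subr.
    have leMr : n%:R ^+ 2 <= 4 * M%:R :> rat by rewrite -natrX -natrM ler_nat.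
    by clear -le_j leMr n0; nra.
  have := cube_sum_ratio j M0; rewrite -EM -/F2 -/F6 => leF.
  apply: le_trans (ler_wpM2r d1 leF) _.
  rewrite -mulrA -[leRHS]mulr1; apply: ler_wpM2l; first exact: ltW.
  apply: le_trans (pow_one_plus_mul_le j x0); apply: ler_wpM2l; last by rewrite lerD2l lerN2.
  by apply: exprn_ge0; apply: addr_ge0; [exact: ler01 | exact: x0].
(* Uses (1 - d)^2 (1 + 4 d) >= 1, valid for 0 <= d <= 1/4; this is the purpose of n >= 800. *)
have F6F2 : F6 ^+ 2 <= F2 ^+ 2 * (1 + 4 * d).
  have sq : (F6 * (1 - d)) ^+ 2 <= F2 ^+ 2.
    exact: ler_sqr_ge0 (mulr_ge0 F60 d1) F6d.
  apply: le_trans (_ : (F6 * (1 - d)) ^+ 2 * (1 + 4 * d) <= _); last first.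
    by apply: ler_wpM2r sq; move: (d) d0 => e e0; clear -e0; lra.
  rewrite exprMn -mulrA -[leLHS]mulr1; apply: ler_wpM2l; first exact: sqr_ge0.
  by move: (d) d0 d4 => e e0 e4; clear -e0 e4; nra.
have leb : bpm m m./2 <= 4 / n%:R.
  apply: bpm_le; first by apply: divr_ge0; [exact: ler0n | exact: ltW].
  have n02 : 0 < n%:R ^+ 2 :> rat by exact: exprn_gt0.
  rewrite exprMn exprVn mulrAC (ler_pdivlMr _ _ n02) mul1r -!natrX -natrM ler_nat.
  by apply: leq_trans le_m _; rewrite leq_mul2l leqnSn orbT.
have le_m2 : (2 * m <= 'C(n - 5, 2))%N by have := odd_double_half 'C(n - 5, 2); rewrite /m; clear; lia.
have n0' : (0 < n)%N by clear -le_n; lia.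
have Emu : \sum_(t in K) mean K (fun E => (mono_edge E t)%:R) = c * (F2 / 2).
  rewrite (eq_bigr (fun=> F2 / 2)); last by move=> t Kt; exact: mean_mono_edge.
  by rewrite sumr_const card_edges mulr_natl.
have := second_moment (fun E t _ wE _ => not_weakly_weighted1 t wE) Emu.
rewrite -/p => cheb.
have le_pairs : \sum_(t in K) \sum_(t' in K) mean K (fun E => (mono_edge E t && mono_edge E t')%:R) <=
    c * (c * (F6 ^+ 2 / 4) + 2048 / n%:R ^+ 2).
  rewrite /c -card_edges -/K mulr_natl -sumr_const; apply: ler_sum => t Kt.
  rewrite (bigID (fun t' => t :&: t' == set0)) /=; apply: lerD; last first.
    exact: (sum_mean_mono_edge_meet n0' Kt le_m2 leb).
  apply: le_trans (_ : \sum_(t' in K | t :&: t' == set0) F6 ^+ 2 / 4 <= _).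
    apply: ler_sum => t' /andP[Kt' /eqP tt'].
    exact: (mean_mono_edge_disjoint Kt Kt' tt').
  rewrite big_mkcondr /= mulr_natl -sumr_const; apply: ler_sum => t' _.
  case: ifP => _; first exact: lexx.
  by apply: divr_ge0; [exact: sqr_ge0 | exact: ler0n].
have c0 : 0 < c.
  by rewrite ltr0n bin_gt0; clear -le_n; lia.
have lecr : n%:R ^+ 3 <= 27 * 8 * c by rewrite -natrX /c -!natrM ler_nat.
have {le_pairs cheb}cheb := le_trans cheb (lerB le_pairs (lexx _)).
suff: p <= 4 * d + 2048 * (4 * 4 * 27 * 8) / n%:R by [].
have b0 : 0 <= 2048 :> rat := ler0n _ _.
(* What is left is algebra, with b = 2048, x = n, q = p, f = F2, g = F6, a = c and e = d. *)
move: (2048 : rat) (n%:R : rat) (p) (F2) (F6) (c) (d) b0 n0 F20 F6F2 F2p c0 lecr cheb.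
clear => b x q f g a e b0 x0 f20 gf f0 a0 le_a cheb.
have nn : x != 0 by rewrite gt_eqF.
have le_q : q * f ^+ 2 <= g ^+ 2 - f ^+ 2 + 4 * b / (a * x ^+ 2).
  have a4 : 0 < a ^+ 2 / 4 by apply: divr_gt0; [exact: exprn_gt0 | exact: ltr0n].
  have an : a != 0 by rewrite gt_eqF.
  rewrite -(ler_pM2r a4).
  have -> : (g ^+ 2 - f ^+ 2 + 4 * b / (a * x ^+ 2)) * (a ^+ 2 / 4) =
    a * (a * (g ^+ 2 / 4) + b / x ^+ 2) - (a * (f / 2)) ^+ 2.
    by field; rewrite nn an.
  have -> : 4^-1 = 2^-1 ^+ 2 :> rat by apply/eqP.
  have -> : q * f ^+ 2 * (a ^+ 2 * 2^-1 ^+ 2) = q * (a * (f * 2^-1)) ^+ 2 by ring.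
  exact: cheb.
have f22 : 0 < f ^+ 2 by rewrite exprn_gt0.
rewrite -(ler_pM2r f22); apply: le_trans le_q _; rewrite [leRHS]mulrDl.
have h1 : g ^+ 2 - f ^+ 2 <= 4 * e * f ^+ 2.
  rewrite lerBlDr; apply: le_trans gf _.
  have -> : f ^+ 2 * (1 + 4 * e) = 4 * e * f ^+ 2 + f ^+ 2 by ring.
  exact: lexx.
apply: (lerD h1).
have f24 : 1 <= f ^+ 2 * (4 * x ^+ 4).
  have -> : f ^+ 2 * (4 * x ^+ 4) = (f * (2 * x ^+ 2)) ^+ 2 by ring.
  by rewrite exprn_ege1.
rewrite (ler_pdivrMr _ _ (mulr_gt0 a0 (exprn_gt0 2 x0))).
have -> : b * (4 * 4 * 27 * 8) / x * f ^+ 2 * (a * x ^+ 2) =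
  4 * b * (f ^+ 2 * (4 * x ^+ 4) * ((27 * 8 * a) / x ^+ 3)) by field.
rewrite -[leLHS]mulr1; apply: ler_wpM2l; first exact: mulr_ge0.
rewrite -[leLHS]mulr1; apply: ler_pM; [exact: ler01 | exact: ler01 | exact: f24 |].
by rewrite (ler_pdivlMr _ _ (exprn_gt0 3 x0)) mul1r.
Qed.

Lemma prob_weakly_weighted1_decay : exists2 c : rat, 0 <= c & forall n, (800 <= n)%N ->
  mean (edges n 3) (fun E => (weakly_weighted E 1)%:R) <= c / n%:R.
Proof.
have scale (a b d x : rat) : 4 * (a / x) + b * d / x = (4 * a + b * d) / x by ring.
exists (4 * 192 + 2048 * (4 * 4 * 27 * 8)).
  have N0 m : 0 <= m%:R :> rat := ler0n _ m.
  exact: addr_ge0 (mulr_ge0 (N0 4%N) (N0 192%N))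
    (mulr_ge0 (N0 2048%N) (mulr_ge0 (mulr_ge0 (mulr_ge0 (N0 4%N) (N0 4%N)) (N0 27%N)) (N0 8%N))).
move=> n n800; have := prob_weakly_weighted1_le n800; rewrite scale; exact.
Qed.

Lemma prob_weakly_weighted1 k : exists N : nat, forall n, (N <= n)%N ->
  k%:R * mean (edges n 3) (fun E => (weakly_weighted E 1)%:R) <= 1.
Proof.
have [c c0 lec] := prob_weakly_weighted1_decay.
have kc0 : 0 <= k%:R * c by rewrite mulr_ge0 // ler0n.
exists (800 + Num.bound (k%:R * c))%N => n le_n.
have n0 : 0 < n%:R :> rat by rewrite ltr0n (leq_trans _ le_n).
have le_k := ler_wpM2l (ler0n rat k) (lec n (leq_trans (leq_addr _ _) le_n)).
apply: le_trans le_k _; rewrite mulrA (ler_pdivrMr _ _ n0) mul1r.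
apply: le_trans (ltW (archi_boundP kc0)) _; rewrite ler_nat.
exact: leq_trans (leq_addl _ _) le_n.
Qed.

Lemma almost_all_weighted2_not1 :
  almost_all 3 (fun n E => weakly_weighted E 2 && ~~ weakly_weighted E 1).
Proof.
apply: almost_allI => k _.
have [N2 le2] := prob_not_weakly_weighted2 (2 * k).
have [N1 le1] := prob_weakly_weighted1 (2 * k).
exists (maxn N1 N2) => n; rewrite geq_max => /andP[/le1{}le1 /le2{}le2].
apply: (@le_trans _ _ (k%:R * (mean (edges n 3) (fun E => (~~ weakly_weighted E 2)%:R) +
    mean (edges n 3) (fun E => (weakly_weighted E 1)%:R)))).
  rewrite ler_wpM2l ?ler0n // -meanD; apply: mean_le => E _.
  by rewrite negb_and negbK; exact: natr_orb_le.
move: le1 le2; rewrite natrM; move: (mean _ _) (mean _ _) => p q; lra.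
Qed.

Local Close Scope ring_scope.

Theorem theorem1p3 :
  almost_all 3 (fun n E => weakly_weighted E 2 && ~~ weakly_weighted E 1) /\
  (forall r : nat, 4 <= r -> almost_all r (fun n E => weakly_weighted E 1)).
Proof. by split; [exact: almost_all_weighted2_not1 | exact: almost_all_weighted1]. Qed.
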